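(* The permutation classes $\mathrm{Av}(2134,2413)$ and $\mathrm{Av}(2314,3124,13524,12435)$ are Wilf-equivalent, i.e. for every $n\ge0$ they contain the same number of permutations of size $n$.
   Context: A permutation of size $n$ is a word containing each of $1,\dots,n$ exactly once. $\sigma$ contains $\pi$ if some (not necessarily consecutive) subsequence of $\sigma$ has the same relative order as $\pi$; otherwise $\sigma$ avoids $\pi$. $\mathrm{Av}(P)$ is the set of permutations avoiding every element of $P$. *)

(* Defs.v *)
From mathcomp Require Import all_boot.

Set Implicit Arguments.
Unset Strict Implicit.
Unset Printing Implicit Defensive.

Definition is_permutation (s : seq nat) : bool := perm_eq s (iota 1 (size s)).

Definition same_relative_order (s t : seq nat) : bool :=
  (size s == size t) &&
  [forall i : 'I_(size s), forall j : 'I_(size s),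
     (nth 0 s i < nth 0 s j) == (nth 0 t i < nth 0 t j)].

(* The mask m selects the positions of the subsequence; see containsP. *)
Definition contains (s p : seq nat) : bool :=
  [exists m : (size s).-tuple bool, same_relative_order (mask m s) p].

Lemma containsP (s p : seq nat) :
  reflect (exists2 t, subseq t s & same_relative_order t p) (contains s p).
Proof.
apply: (iffP existsP) => [[m Hm]|[t /subseqP[m sz_m ->] Hm]].
  by exists (mask m s); first exact: mask_subseq.
by exists (tcast sz_m (in_tuple m)); rewrite val_tcast.
Qed.

Definition avoids (s p : seq nat) : bool := ~~ contains s p.

Definition Av (P : seq (seq nat)) : pred (seq nat) :=
  [pred s | is_permutation s && all (avoids s) P].

(* [permutations (iota 1 n)] lists, without repetition, the permutations of
   size n. *)
Definition num_of_size (C : pred (seq nat)) (n : nat) : nat :=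
  count C (permutations (iota 1 n)).

Lemma mem_permutations_iota (n : nat) (s : seq nat) :
  (s \in permutations (iota 1 n)) = is_permutation s && (size s == n).
Proof.
rewrite mem_permutations /is_permutation.
apply/idP/andP => [Hs|[Hs /eqP <-]] //.
by have:= perm_size Hs; rewrite size_iota => ->; rewrite eqxx.
Qed.

Definition Wilf_equivalent (C D : pred (seq nat)) : Prop :=
  forall n : nat, num_of_size C n = num_of_size D n.

(* Main.v *)
(** Both generating functions satisfy the same quadratic equation over the Catalan series C
    of Av(213).

    In Av(2134, 2413), let v be the first letter. Either the larger letters follow v
    immediately, and the permutation is a skew sum, or it has the form
    v alpha delta1 beta delta2 with delta1 delta2 < v < alpha < beta, where delta1 and beta
    are nonempty, beta is decreasing and alpha avoids 213. The number of words
    delta1 beta delta2 of size m telescopes to a_m - 1, so that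
    A = 1 + x A^2 + x C (A - 1 / (1 - x)).

    In Av(2314, 3124, 13524, 12435), let P_h count the permutations whose first h letters
    decrease. For h > 0 the letters directly after them that exceed the first letter form a
    block of largest values, which may be any element of Av(2413, 1324, 2314, 3124);
    removing it gives P_h = E (P_(h+1) + x (P_(h-1) - P_h)). Removing similar blocks, now from
    Av(213), in the permutations counted by E gives E (2 - x - (1 - x) C) = 1. So P_h
    satisfies a linear recurrence of order two, and P_h = O(x^h) forces P_0 P_2 = P_1^2;
    with P_0 = 1 + P_1 this is a quadratic equation for P_0 = B. *)

Require Import Defs.
From mathcomp Require Import all_boot all_algebra.
From mathcomp Require Import zify ring.

Set Implicit Arguments.
Unset Strict Implicit.
Unset Printing Implicit Defensive.

(** * Insertion of a block into a permutation *)

Local Notation perms n := (permutations (iota 1 n)).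

Lemma mem_perms n (s : seq nat) :
  (s \in perms n) = [&& uniq s, size s == n & all (fun x => 0 < x <= n) s].
Proof.
rewrite mem_permutations; apply/idP/and3P => [Hs|[Us /eqP Ss As]].
  split; first by rewrite (perm_uniq Hs) iota_uniq.
    by rewrite (perm_size Hs) size_iota.
  by apply/allP => x; rewrite (perm_mem Hs) mem_iota; lia.
have sub: {subset s <= iota 1 n}.
  by move=> x /(allP As); rewrite mem_iota; lia.
apply: uniq_perm => //; first exact: iota_uniq.
by have [] := uniq_min_size Us sub; rewrite ?size_iota ?Ss.
Qed.

Lemma perms_uniq (n : nat) (s : seq nat) : s \in perms n -> uniq s.
Proof. by rewrite mem_perms => /and3P[]. Qed.

Lemma perms_size (n : nat) (s : seq nat) : s \in perms n -> size s = n.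
Proof. by rewrite mem_perms => /and3P[_ /eqP]. Qed.

Lemma perms_bounds (n x : nat) (s : seq nat) : s \in perms n -> x \in s -> 0 < x <= n.
Proof. by rewrite mem_perms => /and3P[_ _ /allP]; apply. Qed.

Lemma perms_mem (n x : nat) (s : seq nat) : s \in perms n -> (x \in s) = (0 < x <= n).
Proof. by rewrite mem_permutations => /perm_mem->; rewrite mem_iota; lia. Qed.

Lemma perms_count_gt (n v : nat) (s : seq nat) :
  s \in perms n -> count (fun x => v < x) s = n - v.
Proof.
rewrite mem_permutations => /permP->.
case: (leqP v n) => [le_vn|lt_nv]; last first.
  rewrite (eq_in_count (a2 := pred0)) ?count_pred0 => [|x]; first by lia.
  by rewrite mem_iota /=; lia.
rewrite -{1}(subnKC le_vn) iotaD count_cat.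
rewrite (eq_in_count (a2 := pred0)) ?count_pred0 => [|x]; last first.
  by rewrite mem_iota /=; lia.
rewrite (eq_in_count (a2 := predT)) ?count_predT ?size_iota // => x.
by rewrite mem_iota /=; lia.
Qed.

(** Opens the gap (k, k + b] among the values and keeps the order. *)
Definition shift (k b x : nat) : nat := if x <= k then x else x + b.

Lemma shift_mono k b : {mono shift k b : x y / x < y}.
Proof. by move=> x y; rewrite /shift; case: (leqP x k); case: (leqP y k); lia. Qed.

Lemma shift_inj k b : injective (shift k b).
Proof. by move=> x y; rewrite /shift; case: (leqP x k); case: (leqP y k); lia. Qed.

(* The block w is inserted at position h of s, in the value interval (k, k + size w]. *)
Definition ins (h k : nat) (w s : seq nat) : seq nat :=
  take h (map (shift k (size w)) s) ++ map (addn k) w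
  ++ drop h (map (shift k (size w)) s).

Lemma size_ins h k w s : size (ins h k w s) = size s + size w.
Proof.
by rewrite !size_cat !size_map addnCA -size_cat cat_take_drop size_map addnC.
Qed.

Lemma perm_ins h k w s :
  perm_eq (ins h k w s) (map (addn k) w ++ map (shift k (size w)) s).
Proof. by rewrite /ins perm_catCA cat_take_drop. Qed.

Lemma ins_perms (n b h k : nat) (w s : seq nat) :
  k <= n -> w \in perms b -> s \in perms n -> ins h k w s \in perms (n + b).
Proof.
move=> le_kn Hw Hs; rewrite mem_perms size_ins (perms_size Hw) (perms_size Hs).
rewrite eqxx (perm_uniq (perm_ins _ _ _ _)) (perm_all _ (perm_ins _ _ _ _)).
rewrite cat_uniq !map_inj_uniq; [|exact: shift_inj|exact: addnI].
rewrite (perms_uniq Hw) (perms_uniq Hs) (perms_size Hw) all_cat /= andbT.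
apply/and3P; split.
- apply/hasPn => _ /mapP[x _ ->]; apply/mapP => -[y /(perms_bounds Hw)].
  by rewrite /shift; case: (leqP x k); lia.
- by apply/allP => _ /mapP[x /(perms_bounds Hw) Hx ->]; lia.
by apply/allP => _ /mapP[x /(perms_bounds Hs) Hx ->]; rewrite /shift; case: (leqP x k); lia.
Qed.

Lemma ins_inj (n b h k : nat) (w1 s1 w2 s2 : seq nat) : h <= n ->
  w1 \in perms b -> s1 \in perms n -> w2 \in perms b -> s2 \in perms n ->
  ins h k w1 s1 = ins h k w2 s2 -> (w1, s1) = (w2, s2).
Proof.
move=> le_hn Hw1 Hs1 Hw2 Hs2; rewrite /ins (perms_size Hw1) (perms_size Hw2).
move/eqP; rewrite eqseq_cat ?size_takel ?size_map ?(perms_size Hs1) ?(perms_size Hs2) //.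
case/andP => /eqP E1; rewrite eqseq_cat ?size_map ?(perms_size Hw1) ?(perms_size Hw2) //.
case/andP => /eqP E2 /eqP E3.
have Es: map (shift k b) s1 = map (shift k b) s2.
  by rewrite -[LHS](cat_take_drop h) E1 E3 cat_take_drop.
by rewrite (inj_map (@addnI k) E2) (inj_map (@shift_inj k b) Es).
Qed.

Lemma ins_surj (n b h k : nat) (s : seq nat) : h <= n -> k <= n -> s \in perms (n + b) ->
  all (fun x => k < x <= k + b) (take b (drop h s)) ->
  exists w t : seq nat, [/\ w \in perms b, t \in perms n & s = ins h k w t].
Proof.
move=> le_hn le_kn Hs Ab; set M := take b (drop h s) in Ab.
set L := take h s; set R := drop b (drop h s).
have Es: s = L ++ M ++ R by rewrite /L /M /R !cat_take_drop.
have SL: size L = h by rewrite size_takel // (perms_size Hs); lia.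
have SM: size M = b by rewrite size_takel // size_drop (perms_size Hs); lia.
have Us := perms_uniq Hs.
have UM: uniq M by move: Us; rewrite Es !cat_uniq => /and5P[].
have ULR: uniq (L ++ R).
  have := perm_uniq (permEl (perm_catCA L M R)); rewrite -Es Us cat_uniq.
  by case: (uniq (L ++ R)); rewrite ?andbF.
have LRM x : x \in L ++ R -> x \notin M.
  have := perm_uniq (permEl (perm_catCA L M R)); rewrite -Es Us cat_uniq.
  by move=> /esym/and3P[_ /hasPn H _] /H.
have MI x : (x \in M) = (k < x <= k + b).
  apply/idP/idP => [/(allP Ab)//|Hx].
  have subM: {subset M <= iota k.+1 b}.
    by move=> y /(allP Ab); rewrite mem_iota; lia.
  have le_size: size (iota k.+1 b) <= size M by rewrite size_iota SM.
  by have [_ ->] := uniq_min_size UM subM le_size; rewrite mem_iota; lia.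
have LRs x : x \in L ++ R -> 0 < x <= n + b.
  move=> Hx; apply: (perms_bounds Hs); rewrite Es !mem_cat.
  by move: Hx; rewrite mem_cat => /orP[->|->]; rewrite ?orbT.
set g := fun x => if x <= k then x else x - b.
have gK x : x \in L ++ R -> shift k b (g x) = x.
  by move=> /LRM; rewrite MI /shift /g; case: (leqP x k) => [->//|]; case: (leqP (x - b) k); lia.
exists (map (subn^~ k) M), (map g (L ++ R)).
have HE: map (addn k) (map (subn^~ k) M) = M.
  rewrite -map_comp map_id_in // => x; rewrite MI /=; lia.
have HE2: map (shift k b) (map g (L ++ R)) = L ++ R.
  by rewrite -map_comp map_id_in // => x /gK.
split; last by rewrite /ins size_map SM HE HE2 -SL take_size_cat // drop_size_cat.
  rewrite mem_perms size_map SM eqxx; apply/and3P; split=> //.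
    by rewrite -(map_inj_uniq (@addnI k)) HE.
  by apply/allP => _ /mapP[x Hx ->]; move: Hx; rewrite MI /=; lia.
rewrite mem_perms size_map; apply/and3P; split.
- by rewrite -(map_inj_uniq (@shift_inj k b)) HE2.
- have := congr1 size Es; rewrite !size_cat (perms_size Hs) SM SL => ?.
  by apply/eqP; lia.
apply/allP => _ /mapP[x Hx ->]; have := gK x Hx; move: (LRM x Hx) (LRs x Hx).
by rewrite MI /g; case: (leqP x k); lia.
Qed.

(** [ins h k] is a bijection from pairs of permutations onto the permutations whose b letters from
    position h on have their values in (k, k + b]. The first condition on P places every counted
    permutation in this image, the second makes P factor. *)
Lemma count_ins n b h k (P Q R : pred (seq nat)) : h <= n -> k <= n ->
    (forall s : seq nat, s \in perms (n + b) -> P s ->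
       all (fun x => k < x <= k + b) (take b (drop h s))) ->
    (forall w s : seq nat, w \in perms b -> s \in perms n ->
       P (ins h k w s) = Q w && R s) ->
  count P (perms (n + b)) = count Q (perms b) * count R (perms n).
Proof.
move=> le_hn le_kn HP HQR.
rewrite -!size_filter -(size_allpairs (ins h k)); apply: perm_size.
apply: uniq_perm.
- by rewrite filter_uniq ?permutations_uniq.
- apply: allpairs_uniq; rewrite ?filter_uniq ?permutations_uniq //.
  move=> [w1 s1] [w2 s2] /allpairsP[[x y] /= [Hx Hy [-> ->]]].
  move=> /allpairsP[[x' y'] /= [Hx' Hy' [-> ->]]].
  move: Hx Hy Hx' Hy'; rewrite !mem_filter => /andP[_ ?] /andP[_ ?] /andP[_ ?] /andP[_ ?].
  exact: (@ins_inj n b).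
move=> s; rewrite mem_filter; apply/andP/allpairsP => [[Ps Hs]|[[w t] /= [Hw Ht ->]]].
  have [w [t [Hw Ht Es]]] := ins_surj le_hn le_kn Hs (HP s Hs Ps).
  exists (w, t); move: Ps; rewrite Es HQR // !mem_filter => /andP[-> ->].
  by rewrite Hw Ht.
move: Hw Ht; rewrite !mem_filter => /andP[Qw Hw] /andP[Rt Ht].
by rewrite HQR // Qw Rt ins_perms.
Qed.

(** The case of [ins] in which the block lies above all letters of s, so that s needs no shift. *)
Definition topins (h : nat) (w s : seq nat) : seq nat :=
  take h s ++ map (addn (size s)) w ++ drop h s.

Lemma ins_top (n h : nat) (w s : seq nat) : s \in perms n -> ins h n w s = topins h w s.
Proof.
move=> Hs; rewrite /ins /topins (perms_size Hs) map_id_in // => x.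
by move=> /(perms_bounds Hs); rewrite /shift; case: (leqP x n); lia.
Qed.

Lemma count_topins n b h (P Q R : pred (seq nat)) : h <= n ->
    (forall s : seq nat, s \in perms (n + b) -> P s ->
       all (fun x => n < x) (take b (drop h s))) ->
    (forall w s : seq nat, w \in perms b -> s \in perms n ->
       P (topins h w s) = Q w && R s) ->
  count P (perms (n + b)) = count Q (perms b) * count R (perms n).
Proof.
move=> le_hn HP HQR; apply: (@count_ins n b h n) => // [s Hs Ps|w s Hw Hs].
  apply/allP => x Hx; rewrite (allP (HP s Hs Ps)) //=.
  by have/mem_drop/(perms_bounds Hs) := mem_take Hx; lia.
by rewrite (ins_top _ _ Hs) HQR.
Qed.

Lemma perms1 : perms 1 = [:: [:: 1]]. Proof. by []. Qed.

Lemma count_max_first n (P R : pred (seq nat)) :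
    (forall s : seq nat, s \in perms n.+1 -> P s -> head 0 s = n.+1) ->
    (forall s : seq nat, s \in perms n -> P (n.+1 :: s) = R s) ->
  count P (perms n.+1) = count R (perms n).
Proof.
move=> HP HR; rewrite -(addn1 n) (@count_topins n 1 0 P predT R) ?mul1n //.
- move=> s Hs; rewrite addn1 in Hs; move=> /(HP s Hs); rewrite drop0.
  by case: s Hs => [|x s] //= _ ->; rewrite take0 /= ltnSn.
move=> w s; rewrite perms1 inE => /eqP-> Hs.
by rewrite /topins take0 drop0 /= (perms_size Hs) addn1 HR.
Qed.

Lemma count_fiber (T : eqType) (P : pred T) (f : T -> nat) (s : seq T) m :
  (forall x, x \in s -> P x -> f x < m) ->
  count P s = \sum_(b < m) count (fun x => P x && (f x == b)) s.
Proof.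
elim: s => [|x s IH] Hs; first by rewrite big1.
rewrite /= IH => [|y Hy]; last by apply: Hs; rewrite inE Hy orbT.
rewrite big_split /=; congr (_ + _).
case Px: (P x) => /=; last by rewrite big1.
have lt_fm := Hs x (mem_head _ _) Px.
rewrite (bigD1 (Ordinal lt_fm)) //= eqxx big1 // => i.
by rewrite -val_eqE /= eq_sym => /negPf->.
Qed.

(** * Avoidance under subsequences and order-preserving maps *)

Lemma avoidsP s p :
  reflect (forall t, subseq t s -> ~~ same_relative_order t p) (avoids s p).
Proof.
rewrite /avoids; apply: (iffP idP) => [/containsP H t Ht|H].
  by apply/negP => Hp; apply: H; exists t.
by apply/containsP => -[t /H/negPf->].
Qed.

Lemma avoids_subseq s t p : subseq t s -> avoids s p -> avoids t p.
Proof.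
move=> Hts /avoidsP H; apply/avoidsP => u Hu.
exact/H/(subseq_trans Hu).
Qed.

Lemma same_relative_orderP (s t : seq nat) :
  reflect (size s = size t /\ forall i j, i < size s -> j < size s ->
    (nth 0 s i < nth 0 s j) = (nth 0 t i < nth 0 t j))
  (same_relative_order s t).
Proof.
apply: (iffP andP) => -[Hs H]; split; try exact/eqP.
  move=> i j Hi Hj; move/forallP/(_ (Ordinal Hi))/forallP/(_ (Ordinal Hj)): H.
  by move/eqP.
by apply/forallP => i; apply/forallP => j; rewrite H.
Qed.

Lemma same_relative_order_map f s p : {mono f : x y / x < y} ->
  same_relative_order (map f s) p = same_relative_order s p.
Proof.
move=> Hf; apply/same_relative_orderP/same_relative_orderP => -[E H].
  rewrite size_map in E H; split=> // i j Hi Hj.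
  by rewrite -H // !(nth_map 0) // Hf.
by rewrite size_map; split=> // i j Hi Hj; rewrite !(nth_map 0) // Hf H.
Qed.

Lemma subseq_mapP (f : nat -> nat) t s :
  subseq t (map f s) -> exists2 u, subseq u s & t = map f u.
Proof.
case/subseqP => m Hm ->; exists (mask m s); first exact: mask_subseq.
by rewrite map_mask.
Qed.

Lemma avoids_map f s p : {mono f : x y / x < y} -> avoids (map f s) p = avoids s p.
Proof.
move=> Hf; apply/avoidsP/avoidsP => H t Ht.
  by rewrite -(same_relative_order_map _ _ Hf) H ?map_subseq.
by have [u Hu ->] := subseq_mapP Ht; rewrite same_relative_order_map // H.
Qed.

(** A first letter v can only play the first letter of p. Some letter of p exceeds that one, whereas
    no letter of s exceeds v. *)
Lemma avoids_max_cons v s p : all (fun x => x < v) s -> has (fun y => head 0 p < y) p ->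
  avoids (v :: s) p = avoids s p.
Proof.
move=> Hv /(has_nthP 0)[j Hj Hp]; apply/idP/idP.
  exact/avoids_subseq/subseq_cons.
move=> /avoidsP H; apply/avoidsP => -[|x t] //=; first by case: p {Hp H} Hj.
case: eqP => [->{x} Ht|_]; last exact: H.
apply/negP => /same_relative_orderP[St Hlt].
rewrite -St in Hj; have := Hlt 0 j isT Hj; rewrite /= nth0 Hp => Hvj.
case: j Hj Hp Hvj => [|j] /= Hj Hp; first by rewrite ltnn.
have /(allP Hv) := mem_subseq Ht (mem_nth 0 (Hj : j < size t)) => /=.
by lia.
Qed.

(** * Pattern containment, letter by letter *)

(** Unlike quantification over ordinals, this form computes on explicit words, so that [lia] can
    decide occurrences of concrete patterns. *)
Lemma same_relative_orderE (s t : seq nat) :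
  same_relative_order s t = (size s == size t) &&
    all (fun i => all (fun j =>
      (nth 0 s i < nth 0 s j) == (nth 0 t i < nth 0 t j)) (iota 0 (size s)))
    (iota 0 (size s)).
Proof.
apply/same_relative_orderP/andP => -[E H]; split; try exact/eqP.
  apply/allP => i; rewrite mem_iota => Hi; apply/allP => j; rewrite mem_iota => Hj.
  by rewrite H.
move=> i j Hi Hj; move/allP/(_ i): H; rewrite mem_iota => /(_ Hi)/allP/(_ j).
by rewrite mem_iota => /(_ Hj)/eqP.
Qed.

(** Here and in the next seven lemmas an occurrence is described by the chain of its letters in
    increasing order; all other comparisons follow from this chain. *)
Lemma avoids213P s :
  (forall a b c : nat, subseq [:: a; b; c] s -> ~~ [&& b < a & a < c]) <->
  avoids s [:: 2; 1; 3].
Proof.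
split=> [H|/avoidsP H a b c /H]; last by rewrite same_relative_orderE /=; lia.
apply/avoidsP => t Ht; apply/negP => Hp; have := Hp => /same_relative_orderP[S _].
case: t Ht Hp S => [|a [|b [|c [|]]]] //= Ht + _; have := H _ _ _ Ht.
by rewrite same_relative_orderE /=; lia.
Qed.

Lemma avoids2134P s :
  (forall a b c d : nat, subseq [:: a; b; c; d] s -> ~~ [&& b < a, a < c & c < d]) <->
  avoids s [:: 2; 1; 3; 4].
Proof.
split=> [H|/avoidsP H a b c d /H]; last by rewrite same_relative_orderE /=; lia.
apply/avoidsP => t Ht; apply/negP => Hp; have := Hp => /same_relative_orderP[S _].
case: t Ht Hp S => [|a [|b [|c [|d [|]]]]] //= Ht + _; have := H _ _ _ _ Ht.
by rewrite same_relative_orderE /=; lia.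
Qed.

Lemma avoids2413P s :
  (forall a b c d : nat, subseq [:: a; b; c; d] s -> ~~ [&& c < a, a < d & d < b]) <->
  avoids s [:: 2; 4; 1; 3].
Proof.
split=> [H|/avoidsP H a b c d /H]; last by rewrite same_relative_orderE /=; lia.
apply/avoidsP => t Ht; apply/negP => Hp; have := Hp => /same_relative_orderP[S _].
case: t Ht Hp S => [|a [|b [|c [|d [|]]]]] //= Ht + _; have := H _ _ _ _ Ht.
by rewrite same_relative_orderE /=; lia.
Qed.

Lemma avoids1324P s :
  (forall a b c d : nat, subseq [:: a; b; c; d] s -> ~~ [&& a < c, c < b & b < d]) <->
  avoids s [:: 1; 3; 2; 4].
Proof.
split=> [H|/avoidsP H a b c d /H]; last by rewrite same_relative_orderE /=; lia.
apply/avoidsP => t Ht; apply/negP => Hp; have := Hp => /same_relative_orderP[S _].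
case: t Ht Hp S => [|a [|b [|c [|d [|]]]]] //= Ht + _; have := H _ _ _ _ Ht.
by rewrite same_relative_orderE /=; lia.
Qed.

Lemma avoids2314P s :
  (forall a b c d : nat, subseq [:: a; b; c; d] s -> ~~ [&& c < a, a < b & b < d]) <->
  avoids s [:: 2; 3; 1; 4].
Proof.
split=> [H|/avoidsP H a b c d /H]; last by rewrite same_relative_orderE /=; lia.
apply/avoidsP => t Ht; apply/negP => Hp; have := Hp => /same_relative_orderP[S _].
case: t Ht Hp S => [|a [|b [|c [|d [|]]]]] //= Ht + _; have := H _ _ _ _ Ht.
by rewrite same_relative_orderE /=; lia.
Qed.

Lemma avoids3124P s :
  (forall a b c d : nat, subseq [:: a; b; c; d] s -> ~~ [&& b < c, c < a & a < d]) <->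
  avoids s [:: 3; 1; 2; 4].
Proof.
split=> [H|/avoidsP H a b c d /H]; last by rewrite same_relative_orderE /=; lia.
apply/avoidsP => t Ht; apply/negP => Hp; have := Hp => /same_relative_orderP[S _].
case: t Ht Hp S => [|a [|b [|c [|d [|]]]]] //= Ht + _; have := H _ _ _ _ Ht.
by rewrite same_relative_orderE /=; lia.
Qed.

Lemma avoids13524P s :
  (forall a b c d e : nat, subseq [:: a; b; c; d; e] s -> ~~ [&& a < d, d < b, b < e & e < c]) <->
  avoids s [:: 1; 3; 5; 2; 4].
Proof.
split=> [H|/avoidsP H a b c d e /H]; last by rewrite same_relative_orderE /=; lia.
apply/avoidsP => t Ht; apply/negP => Hp; have := Hp => /same_relative_orderP[S _].
case: t Ht Hp S => [|a [|b [|c [|d [|e [|]]]]]] //= Ht + _; have := H _ _ _ _ _ Ht.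
by rewrite same_relative_orderE /=; lia.
Qed.

Lemma avoids12435P s :
  (forall a b c d e : nat, subseq [:: a; b; c; d; e] s -> ~~ [&& a < b, b < d, d < c & c < e]) <->
  avoids s [:: 1; 2; 4; 3; 5].
Proof.
split=> [H|/avoidsP H a b c d e /H]; last by rewrite same_relative_orderE /=; lia.
apply/avoidsP => t Ht; apply/negP => Hp; have := Hp => /same_relative_orderP[S _].
case: t Ht Hp S => [|a [|b [|c [|d [|e [|]]]]]] //= Ht + _; have := H _ _ _ _ _ Ht.
by rewrite same_relative_orderE /=; lia.
Qed.

(** * Blocks of large values *)

(** The four classes are predicates on arbitrary words, so that they apply to blocks of letters as
    well as to permutations. *)
Definition classC (s : seq nat) : bool := avoids s [:: 2; 1; 3].
Definition classA (s : seq nat) : bool :=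
  all (avoids s) [:: [:: 2; 1; 3; 4]; [:: 2; 4; 1; 3]].
Definition classE (s : seq nat) : bool :=
  all (avoids s) [:: [:: 2; 4; 1; 3]; [:: 1; 3; 2; 4]; [:: 2; 3; 1; 4]; [:: 3; 1; 2; 4]].
Definition classB (s : seq nat) : bool :=
  all (avoids s) [:: [:: 2; 3; 1; 4]; [:: 3; 1; 2; 4];
                     [:: 1; 3; 5; 2; 4]; [:: 1; 2; 4; 3; 5]].

Lemma classAP s :
  [/\ forall a b c d : nat, subseq [:: a; b; c; d] s -> ~~ [&& b < a, a < c & c < d]
    & forall a b c d : nat, subseq [:: a; b; c; d] s -> ~~ [&& c < a, a < d & d < b]]
  <-> classA s.
Proof.
rewrite /classA /= andbT; split=> [[/avoids2134P-> /avoids2413P->]//|].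
by case/andP => /avoids2134P ? /avoids2413P ?.
Qed.

Lemma classEP s :
  [/\ forall a b c d : nat, subseq [:: a; b; c; d] s -> ~~ [&& c < a, a < d & d < b],
      forall a b c d : nat, subseq [:: a; b; c; d] s -> ~~ [&& a < c, c < b & b < d],
      forall a b c d : nat, subseq [:: a; b; c; d] s -> ~~ [&& c < a, a < b & b < d]
    & forall a b c d : nat, subseq [:: a; b; c; d] s -> ~~ [&& b < c, c < a & a < d]]
  <-> classE s.
Proof.
rewrite /classE /= andbT; split=> [[/avoids2413P-> /avoids1324P-> /avoids2314P-> /avoids3124P->]//|].
by case/and4P => /avoids2413P ? /avoids1324P ? /avoids2314P ? /avoids3124P ?.
Qed.

Lemma classBP s :
  [/\ forall a b c d : nat, subseq [:: a; b; c; d] s -> ~~ [&& c < a, a < b & b < d],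
      forall a b c d : nat, subseq [:: a; b; c; d] s -> ~~ [&& b < c, c < a & a < d],
      forall a b c d e : nat, subseq [:: a; b; c; d; e] s ->
        ~~ [&& a < d, d < b, b < e & e < c]
    & forall a b c d e : nat, subseq [:: a; b; c; d; e] s ->
        ~~ [&& a < b, b < d, d < c & c < e]]
  <-> classB s.
Proof.
rewrite /classB /= andbT; split=> [[/avoids2314P-> /avoids3124P-> /avoids13524P-> /avoids12435P->]//|].
by case/and4P => /avoids2314P ? /avoids3124P ? /avoids13524P ? /avoids12435P ?.
Qed.

Lemma all_avoids_subseq (ps : seq (seq nat)) s t :
  subseq t s -> all (avoids s) ps -> all (avoids t) ps.
Proof. by move=> Hts; apply: sub_all => p; apply: avoids_subseq. Qed.

Lemma all_avoids_map (ps : seq (seq nat)) f s : {mono f : x y / x < y} ->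
  all (avoids (map f s)) ps = all (avoids s) ps.
Proof. by move=> Hf; apply: eq_all => p; apply: avoids_map. Qed.

Lemma all_avoids_max_cons (ps : seq (seq nat)) v s : all (fun x => x < v) s ->
    all (fun p => has (fun y => head 0 p < y) p) ps ->
  all (avoids (v :: s)) ps = all (avoids s) ps.
Proof. by move=> Hv /allP Hp; apply: eq_in_all => p /Hp; apply: avoids_max_cons. Qed.

(** * Occurrences cut between three zones *)

Lemma all_subseq (T : eqType) (P : pred T) t s : subseq t s -> all P s -> all P t.
Proof. by move=> /mem_subseq Hts /allP Hs; apply/allP => x /Hts/Hs. Qed.

(** The cut is given by two numbers, so that for an explicit pattern each choice of them turns the
    three pieces into explicit words. *)
Lemma subseq_cat3 (T : eqType) (t L M R : seq T) : subseq t (L ++ M ++ R) ->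
  exists i j, [/\ i + j <= size t, subseq (take i t) L,
    subseq (take j (drop i t)) M & subseq (drop j (drop i t)) R].
Proof.
have cat2 (u s1 s2 : seq T) : subseq u (s1 ++ s2) -> exists i,
    [/\ i <= size u, subseq (take i u) s1 & subseq (drop i u) s2].
  case/subseqP => m Sm ->.
  have S1: size (take (size s1) m) = size s1.
    by rewrite size_takel // Sm size_cat leq_addr.
  have ->: mask m (s1 ++ s2) =
      mask (take (size s1) m) s1 ++ mask (drop (size s1) m) s2.
    by rewrite -mask_cat ?cat_take_drop.
  exists (size (mask (take (size s1) m) s1)).
  by rewrite size_cat leq_addr take_size_cat // drop_size_cat // !mask_subseq.
move=> /cat2[i [Hi HL /cat2[j [Hj HM HR]]]]; exists i, j; split=> //.
by move: Hj; rewrite size_drop; lia.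
Qed.

(** If larger letters are inserted between L and R, one of them would form a 2413 with such d, y and
    z. *)
Definition across (L R : seq nat) : bool :=
  all (fun d => pairwise (fun y z => ~~ (y < d < z)) R) L.

Lemma across_subseq L R L' R' :
  subseq L' L -> subseq R' R -> across L R -> across L' R'.
Proof.
move=> HL HR /(all_subseq HL); apply: sub_all => d.
exact: subseq_pairwise.
Qed.


(* One goal for each way to cut an occurrence of a pattern between L, M and R. *)
Ltac zone_cases :=
  move=> /subseq_cat3[[|[|[|[|[|[|?]]]]]] [[|[|[|[|[|[|?]]]]]] [//= _ ZL ZM ZR]]].

(** Only facts moved into the goal beforehand are left for [lia]. *)
Ltac compare := rewrite /across /=; clear; lia.

(** An occurrence that meets M without lying in it is impossible, as L decreases and [across L R]
    holds, or is a 1324 whose last three letters form a 213 in M. All four patterns contain 213, so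
    none lies in M. *)
Lemma classE_block n L M R :
  all (leq^~ n) L -> all (fun x => n < x) M -> all (leq^~ n) R ->
  pairwise (fun x y => y < x) L -> across L R ->
  classE (L ++ R) -> classC M -> classE (L ++ M ++ R).
Proof.
move=> aL aM aR dL LR /classEP[E1 E2 E3 E4] /avoids213P C1.
apply/classEP; split=> a b c d; zone_cases;
  move: (all_subseq ZL aL) (all_subseq ZM aM) (all_subseq ZR aR)
    (subseq_pairwise ZL dL) (across_subseq ZL ZR LR);
  try compare; move=> _ _ _ _ _.
all: first
  [ exact: (E1 _ _ _ _ (cat_subseq ZL ZR)) | exact: (E2 _ _ _ _ (cat_subseq ZL ZR))
  | exact: (E3 _ _ _ _ (cat_subseq ZL ZR)) | exact: (E4 _ _ _ _ (cat_subseq ZL ZR))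
  | by move: (C1 _ _ _ ZM); compare
  | by move: (C1 _ _ _ (subseq_trans (mask_subseq [:: false; true; true; true] _) ZM)); compare
  | by move: (C1 _ _ _ (subseq_trans (mask_subseq [:: true; false; true; true] _) ZM)); compare
  | by move: (C1 _ _ _ (subseq_trans (mask_subseq [:: true; true; false; true] _) ZM)); compare ].
Qed.

(** The length of the run of letters, starting at position h, that are not below the first letter;
    this run is the block to be removed. *)
Definition blk (h : nat) (s : seq nat) : nat :=
  find (fun x => x < head 0 s) (drop h s).

Lemma head_max n (v : nat) (s : seq nat) :
  v :: s \in perms n.+1 -> all (fun x => x < v) s -> v = n.+1.
Proof.
move=> Hs Hv; have: n.+1 \in v :: s by rewrite (perms_mem _ Hs) ltnSn.
have := perms_bounds Hs (mem_head v s).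
by rewrite inE => Hvn /orP[/eqP//|/(allP Hv)] /=; lia.
Qed.

Lemma blk_max_first h v s : all (fun x => x < v) s -> blk h.+1 (v :: s) = 0.
Proof.
rewrite /blk /= => Hv; have: all (fun x => x < v) (drop h s).
  by apply/allP => x /mem_drop /(allP Hv).
by case: (drop h s) => //= x t /andP[->].
Qed.

(** An empty block puts the second letter below the first, which P turns into a first letter that is
    the maximum. The default 0 of [head] lets an empty tail count as falling below v. *)
Lemma count_blk0_max n (P R : pred (seq nat)) :
    (forall (v : nat) (s : seq nat), v :: s \in perms n.+1 -> P (v :: s) -> head 0 s < v ->
       all (fun x => x < v) s) ->
    (forall s : seq nat, s \in perms n -> all (fun x => x < n.+1) s ->
       P (n.+1 :: s) = R s) ->
  count (fun s => P s && (blk 1 s == 0)) (perms n.+1) = count R (perms n).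
Proof.
move=> HP HR; apply: count_max_first => [[|v s] Hs //= /andP[Ps]|s Hs /=].
- by have := perms_size Hs.
- have v0 : 0 < v by have := perms_bounds Hs (mem_head v s); lia.
  rewrite /blk /= drop0 => Hf; apply: (head_max Hs); apply: HP => //.
  by case: s Hs Ps Hf => //= x s _ _; case: (x < v).
have Hn : all (fun x => x < n.+1) s by apply/allP => x /(perms_bounds Hs); lia.
by rewrite blk_max_first // andbT HR.
Qed.

(** If the block M after the first h + 1 letters exceeds all others, it takes the b largest values,
    and its removal inverts [topins]. What is left has an empty block at the same place. *)
Lemma count_blk n b h (P Q R : pred (seq nat)) : h < n ->
    (forall (v : nat) (L M T : seq nat), v :: L ++ M ++ T \in perms (n + b) -> size L = h ->
       size M = b -> all (fun x => v < x) M -> head 0 T < v ->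
       P (v :: L ++ M ++ T) -> forall m x : nat, m \in M -> x \in L ++ T -> x < m) ->
    (forall w, Q (map (addn n) w) = Q w) ->
    (forall (v : nat) (L M T : seq nat), v :: L ++ T \in perms n -> size L = h -> size M = b ->
       head 0 T < v -> all (leq^~ n) (v :: L) -> all (fun x => n < x) M -> all (leq^~ n) T ->
       P (v :: L ++ M ++ T) = Q M && R (v :: L ++ T)) ->
  count (fun s => P s && (blk h.+1 s == b)) (perms (n + b)) =
    count Q (perms b) * count (fun s => R s && (blk h.+1 s == 0)) (perms n).
Proof.
move=> lt_hn H1 HQ H2; apply: (@count_topins n b h.+1) => //.
  case=> [|v s] Hs /=; first by have := perms_size Hs; rewrite /=; lia.
  case/andP => Ps /eqP; rewrite /blk /= => Hb.
  set L := take h s; set M := take b (drop h s); set T := drop b (drop h s).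
  have Es : s = L ++ M ++ T by rewrite /L /M /T !cat_take_drop.
  have Ss : (size s).+1 = n + b by rewrite -(perms_size Hs).
  have SL : size L = h by rewrite size_takel //; lia.
  have SM : size M = b by rewrite size_takel // size_drop; lia.
  have Us := perms_uniq Hs.
  have vM : all (fun x => v < x) M.
    apply/(all_nthP 0) => i; rewrite SM => Hi.
    have Hv : nth 0 M i != v.
      apply: contraTneq Us => <-; rewrite cons_uniq Es !mem_cat mem_nth ?orbT ?SM //.
    have := before_find 0 (a := fun x => x < v) (s := drop h s) (i := i).
    by rewrite Hb Hi -(nth_take _ Hi) -/M => /(_ isT); lia.
  have v0 : 0 < v by have := perms_bounds Hs (mem_head v s); lia.
  have vT : head 0 T < v.
    rewrite -nth0 nth_drop addn0.
    case: (ltnP b (size (drop h s))) => Hsz; last by rewrite nth_default.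
    by rewrite -{1}Hb; apply: (@nth_find _ 0 (fun x => x < v)); rewrite has_find Hb.
  rewrite Es in Hs Ps Us; have Hlt := H1 v L M T Hs SL SM vM vT Ps.
  apply/allP => m Hm; rewrite ltnNge; apply/negP => le_mn.
  (* The n letters outside M are distinct and below m, which is impossible for m at most n. *)
  have sub : {subset v :: L ++ T <= iota 1 m.-1}.
    move=> x Hx; rewrite mem_iota.
    have /(perms_bounds Hs) : x \in v :: L ++ M ++ T.
      move: Hx; rewrite !inE !mem_cat.
      by case/orP => [->//|/orP[->|->]]; rewrite ?orbT.
    move: Hx; rewrite inE => /orP[/eqP->|/(Hlt m x Hm)]; last by lia.
    by have /= := allP vM _ Hm; lia.
  have ULT : uniq (v :: L ++ T).
    apply: subseq_uniq Us; rewrite /= eqxx; apply: cat_subseq => //.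
    exact: suffix_subseq.
  have := uniq_leq_size ULT sub; rewrite size_iota /= size_cat SL.
  by have := congr1 size Es; rewrite !size_cat SL SM; lia.
move=> w [|v s] Hw Hs; first by have := perms_size Hs; rewrite /=; lia.
have Sn : (size s).+1 = n by rewrite -(perms_size Hs).
have le_n : all (leq^~ n) (v :: s) by apply/allP => x /(perms_bounds Hs); lia.
have gt_n : all (fun x => n < x) (map (addn n) w).
  by apply/allP => _ /mapP[x /(perms_bounds Hw) Hx ->]; lia.
have SL : size (take h s) = h by rewrite size_takel; lia.
have v0 : 0 < v by have /andP[] := perms_bounds Hs (mem_head v s).
(* With and without the inserted block, the condition on [blk] says that the next letter is below v;
   an absent letter counts as 0. *)
have -> : (blk h.+1 (topins h.+1 w (v :: s)) == b) = (head 0 (drop h s) < v).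
  rewrite /topins /blk /= Sn drop_size_cat // find_cat.
  have /negPf-> : ~~ has (fun x => x < v) (map (addn n) w).
    apply/hasPn => x /(allP gt_n) /=; rewrite -leqNgt => /ltnW.
    by apply: leq_trans; have /andP[] := perms_bounds Hs (mem_head v s).
  rewrite size_map (perms_size Hw) -{2}[b]addn0 eqn_add2l.
  by case: (drop h s) => [|x t] /=; rewrite ?v0 //; case: (x < v).
have -> : (blk h.+1 (v :: s) == 0) = (head 0 (drop h s) < v).
  by rewrite /blk /=; case: (drop h s) => [|x t] /=; rewrite ?v0 //; case: (x < v).
case vT : (head 0 (drop h s) < v); rewrite ?andbF // !andbT.
move: le_n; rewrite /= -{1}(cat_take_drop h s) all_cat => /and3P[le_v le_L le_T].
by rewrite /topins /= Sn H2 ?cat_take_drop ?size_map ?(perms_size Hw) ?HQ //= le_v.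
Qed.

(** * Av(213) *)

Lemma addn_mono n : {mono addn n : x y / x < y}.
Proof. by move=> x y; rewrite ltn_add2l. Qed.

(** A 213 that meets M has its 3 there, since nothing outside M exceeds a letter of M; the first
    letter v cannot be its 2, because the 1 would have to lie in M too. *)
Lemma classC_block n v M T : v <= n -> all (fun x => n < x) M -> all (leq^~ n) T ->
  classC (v :: M ++ T) = classC M && classC (v :: T).
Proof.
move=> le_vn aM aT; apply/idP/andP => [H|[/avoids213P HM /avoids213P HT]].
  split; apply: avoids_subseq H.
    by apply: subseq_trans (prefix_subseq _ T) _; apply: subseq_cons.
  by rewrite /= eqxx suffix_subseq.
(* The first letter is generalized to a word of length at most one, to serve as the left zone of
   [zone_cases]. *)
have : size [:: v] <= 1 by [].
have : all (leq^~ n) [:: v] by rewrite /= le_vn.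
rewrite -[v :: M ++ T]/([:: v] ++ M ++ T) -[v :: T]/([:: v] ++ T) in HT *.
move: [:: v] HT => L HT aL sL.
apply/avoids213P => a b c; zone_cases;
  move: (all_subseq ZL aL) (all_subseq ZM aM) (all_subseq ZR aT)
    (leq_trans (size_subseq ZL) sL); try compare; move=> _ _ _ _.
all: first [exact: (HT _ _ _ (cat_subseq ZL ZR)) | exact: (HM _ _ _ ZM)].
Qed.

Lemma blk_size h s : blk h s <= size s - h.
Proof. by rewrite /blk -size_drop find_size. Qed.

(** Otherwise v, the first letter of T and x form a 213. *)
Lemma classC_tail v M T x :
  classC (v :: M ++ T) -> head 0 T < v -> x \in T -> x <= v.
Proof.
move=> /avoids213P CvMT; case: T CvMT => // t T CvMT /= lt_tv.
rewrite inE => /orP[/eqP->|xT]; first exact: ltnW.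
have : subseq [:: v; t; x] (v :: M ++ t :: T).
  rewrite /= eqxx; apply: subseq_trans (suffix_subseq M _).
  by rewrite /= eqxx sub1seq.
by move=> /CvMT; lia.
Qed.

Lemma perms_all_lt n v s : v :: s \in perms n -> (forall x, x \in s -> x <= v) ->
  all (fun x => x < v) s.
Proof.
move=> /perms_uniq /= /andP[vs _] le_v; apply/allP => x xs.
by rewrite ltn_neqAle le_v // andbT; apply: contraNneq vs => <-.
Qed.

(** The Catalan recurrence: b is the length of the run of larger letters after the first letter.
    Once this run is removed, the first letter is the maximum and can be removed too. *)
Lemma num_classC_rec n :
  num_of_size classC n.+1 =
    \sum_(b < n.+1) num_of_size classC b * num_of_size classC (n - b).
Proof.
rewrite /num_of_size (@count_fiber _ _ (blk 1) _ n.+1) => [|s Hs _]; last first.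
  by have := blk_size 1 s; rewrite (perms_size Hs); lia.
apply: eq_bigr => b _; have Hb : b <= n by rewrite -ltnS.
move: (nat_of_ord b) Hb => {}b Hb.
rewrite -{1}(subnK Hb) -addSn (@count_blk _ _ 0 _ classC classC) //.
- congr (_ * _); apply: count_blk0_max => [v s Hs Cs Hh|s Hs Hn].
    by apply: perms_all_lt Hs _ => x; exact: (@classC_tail v [::] s x Cs Hh).
  exact: avoids_max_cons.
- move=> v [|//] M T _ _ _ vM vT Cs m x mM xT.
  exact: (leq_ltn_trans (@classC_tail v M T x Cs vT xT) (allP vM m mM)).
- by move=> w; apply: avoids_map; apply: addn_mono.
move=> v [|//] M T _ _ _ _ /andP[le_v _] aM aT.
exact: classC_block le_v aM aT.
Qed.

(** * Av(2134, 2413) *)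

Lemma pairwise_subseqP (r : rel nat) s :
  reflect (forall x y, subseq [:: x; y] s -> r x y) (pairwise r s).
Proof.
apply: (iffP idP) => [Hs x y /subseq_pairwise/(_ Hs)|]; first by rewrite /= !andbT.
elim: s => //= z s IH H; rewrite IH => [|x y Hxy].
  rewrite andbT; apply/allP => y Hy; apply: H; rewrite eqxx.
  by rewrite sub1seq.
apply: H; case: eqP => // _.
by apply: subseq_trans Hxy; apply: subseq_cons.
Qed.

(** The skew sum case. All letters below v come after all letters above it, so v is the 2 of neither
    pattern, and no occurrence meets both M and T. *)
Lemma classA_head_block n v M T : v <= n ->
  all (fun x => n < x) M -> all (fun x => x < v) T ->
  classA (v :: M ++ T) = classA M && classA (v :: T).
Proof.
move=> le_vn aM aT; apply/idP/andP => [H|[/classAP[M1 M2] /classAP]].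
  split; apply: all_avoids_subseq H.
    by apply: subseq_trans (prefix_subseq _ T) _; apply: subseq_cons.
  by rewrite /= eqxx suffix_subseq.
have : size [:: v] <= 1 by [].
have : all (fun x => v <= x <= n) [:: v] by rewrite /= leqnn le_vn.
rewrite -[v :: M ++ T]/([:: v] ++ M ++ T) -[v :: T]/([:: v] ++ T).
move: [:: v] => L aL sL [T1 T2].
apply/classAP; split=> a b c d; zone_cases;
  move: le_vn (all_subseq ZL aL) (all_subseq ZM aM) (all_subseq ZR aT)
    (leq_trans (size_subseq ZL) sL); try compare; move=> _ _ _ _ _.
all: first [exact: (T1 _ _ _ _ (cat_subseq ZL ZR)) | exact: (M1 _ _ _ _ ZM)
  | exact: (T2 _ _ _ _ (cat_subseq ZL ZR)) | exact: (M2 _ _ _ _ ZM)].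
Qed.

(** Here V is v alpha and T is delta1 beta delta2. An occurrence cut between them would need a 213
    in V, an ascent above k in T, a large-small-large triple in T, or a letter of T between two
    values of V. *)
Lemma classA_glue k K V T :
  all (fun x => k < x <= K) V -> all (fun x => (x <= k) || (K < x)) T ->
  pairwise (fun x y => ~~ (k < x < y)) T ->
  (forall x y z : nat, subseq [:: x; y; z] T -> ~~ [&& k < x, y <= k & k < z]) ->
  classC V -> classA T -> classA (V ++ T).
Proof.
move=> aV aT dT NT /avoids213P C1 /classAP[A1 A2]; rewrite -[T]cats0.
apply/classAP; split=> a b c d; zone_cases;
  move: (all_subseq ZL aV) (all_subseq ZM aT) (subseq_pairwise ZM dT);
  try compare.
all: first
  [ by move: (A1 _ _ _ _ ZM); compare
  | by move: (A2 _ _ _ _ ZM); compare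
  | by move: (NT _ _ _ ZM); compare
  | by move: (C1 _ _ _ ZL); compare
  | by move: (C1 _ _ _ (subseq_trans (mask_subseq [:: true; true; true; false] _) ZL)); compare
  | by move: (C1 _ _ _ (subseq_trans (mask_subseq [:: true; false; true; true] _) ZL)); compare ].
Qed.

(** An occurrence uses at most one letter of a decreasing block of large letters, and this letter
    plays the 4; the letter m can replace it. *)
Lemma classA_dec_block n L m M1 M2 R : all (leq^~ n) L -> all (leq^~ n) R ->
  all (fun x => n < x) (m :: M1) -> all (fun x => n < x) M2 ->
  pairwise (fun x y => ~~ (x < y)) M2 ->
  classA (L ++ (m :: M1) ++ R) -> classA (L ++ M2 ++ R).
Proof.
move=> aL aR /andP[lt_nm _] aM dM /classAP[A1 A2].
have Zm : subseq [:: m] (m :: M1) by rewrite /= eqxx sub0seq.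
apply/classAP; split=> a b c d; zone_cases;
  move: lt_nm (all_subseq ZL aL) (all_subseq ZM aM) (all_subseq ZR aR)
    (subseq_pairwise ZM dM); try compare.
all: first
  [ by move: (A1 _ _ _ _ (cat_subseq ZL (cat_subseq (sub0seq (m :: M1)) ZR))); compare
  | by move: (A2 _ _ _ _ (cat_subseq ZL (cat_subseq (sub0seq (m :: M1)) ZR))); compare
  | by move: (A1 _ _ _ _ (cat_subseq ZL (cat_subseq Zm ZR))); compare
  | by move: (A2 _ _ _ _ (cat_subseq ZL (cat_subseq Zm ZR))); compare ].
Qed.

(** * Words with a decreasing block of top letters *)

Lemma take_count_gt k D : pairwise (fun x y => ~~ (x <= k < y)) D ->
  all (fun x => k < x) (take (count (fun x => k < x) D) D).
Proof.
elim: D => //= x D IH /andP[Hx HD]; case: (ltnP k x) => Hkx; last first.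
  rewrite add0n; have /eqP-> : count (fun y => k < y) D == 0.
    by rewrite -leqn0 leqNgt -has_count; apply/hasPn => y /(allP Hx) /=; rewrite Hkx.
  by rewrite take0.
by rewrite add1n /= Hkx IH.
Qed.

Lemma find_count_le k s :
  find (fun x => k < x) s + count (fun x => k < x) s <= size s.
Proof. by elim: s => //= x s IH; case: (k < x) => /=; have := count_size (fun x => k < x) s; lia. Qed.

Lemma count_drop_find k s :
  count (fun x => k < x) (drop (find (fun x => k < x) s) s) = count (fun x => k < x) s.
Proof. by elim: s => //= x s IH; case: ifP => //= ->. Qed.

Lemma count_noninc b :
  count (fun w => pairwise (fun x y => ~~ (x < y)) w) (perms b) = 1.
Proof.
elim: b => // b IH; rewrite -{2}IH; apply: count_max_first => [[|v s] Hs|s Hs] /=.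
- by have := perms_size Hs.
- case/andP => /allP Hv _; apply: (head_max Hs); apply: perms_all_lt Hs _ => x /Hv.
  by rewrite -leqNgt.
suff -> : all (fun y => ~~ (b.+1 < y)) s by [].
by apply/allP => x /(perms_bounds Hs); lia.
Qed.

(* The words delta1 beta delta2 of the decomposition, beta being the letters above k. *)
Definition classA_top (k : nat) (s : seq nat) : bool :=
  [&& classA s, head 0 s <= k, pairwise (fun x y => ~~ (k < x < y)) s
    & pairwise (fun x y => ~~ (x <= k < y)) (drop (find (fun x => k < x) s) s)].

(** In a permutation of size k + 1 the only letter above k is the maximum, so [find] gives its
    position. *)
Lemma num_classA_at k h : h <= k ->
  count (fun s => classA s && (find (fun x => k < x) s == h)) (perms k.+1) =
  count (fun s => classA (topins h [:: 1] s)) (perms k).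
Proof.
move=> le_hk; set P := fun s => _.
have := @count_topins k 1 h P predT (fun s => classA (topins h [:: 1] s)) le_hk.
rewrite addn1 mul1n; apply; rewrite {}/P.
  move=> s Hs /andP[_ /eqP Hf].  have Hh : has (fun x => k < x) s.
    by apply/hasP; exists k.+1; rewrite ?(perms_mem _ Hs) ?ltnSn.
  have lt_hs : h < size s by have := Hh; rewrite has_find Hf.
  rewrite (drop_nth 0 lt_hs) /= take0 andbT -Hf.
  exact: (nth_find 0 Hh).
move=> w s; rewrite perms1 inE => /eqP-> Hs; rewrite andbC.
suff -> : find (fun x => k < x) (topins h [:: 1] s) = h by rewrite eqxx.
rewrite /topins (perms_size Hs) find_cat size_takel ?(perms_size Hs) //=.
rewrite addn1 ltnSn addn0 ifF //; apply/negbTE/hasPn => x /mem_take.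
by move=> /(perms_bounds Hs) /=; lia.
Qed.

Lemma num_classA_at0 k :
  count (fun s => classA (topins 0 [:: 1] s)) (perms k) = num_of_size classA k.
Proof.
apply: eq_in_count => s Hs; rewrite /topins take0 drop0 /= (perms_size Hs) addn1.
apply: all_avoids_max_cons => //; apply/allP => x /(perms_bounds Hs); lia.
Qed.

Lemma num_classA_sum k :
  num_of_size classA k.+1 =
    \sum_(h < k.+1) count (fun s => classA (topins h [:: 1] s)) (perms k).
Proof.
rewrite /num_of_size (@count_fiber _ _ (find (fun x => k < x)) _ k.+1).
  by apply: eq_bigr => h _; apply: num_classA_at; rewrite -ltnS.
move=> s Hs _; rewrite -[X in _ < X](perms_size Hs) -has_find.
by apply/hasP; exists k.+1; rewrite ?(perms_mem _ Hs) ?ltnSn.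
Qed.

(** The b letters above k form one decreasing block at position h, and this block can be shrunk to a
    single letter. The bound on h reflects that delta1 is nonempty. *)
Lemma num_classA_top_at k b h : 0 < h <= k -> 0 < b ->
  count (fun s => classA_top k s && (find (fun x => k < x) s == h)) (perms (k + b)) =
  count (fun s => classA (topins h [:: 1] s)) (perms k).
Proof.
move=> /andP[h0 le_hk] b0.
rewrite (@count_topins k b h _ (pairwise (fun x y => ~~ (x < y)))
           (fun s => classA (topins h [:: 1] s))) ?count_noninc ?mul1n //.
  move=> s Hs /andP[/and4P[_ _ _ Hp] /eqP Hf]; rewrite Hf in Hp.
  have := take_count_gt Hp; rewrite -{1}Hf count_drop_find (perms_count_gt _ Hs).
  by rewrite addKn.
move=> w s Hw Hs; rewrite /topins (perms_size Hs).
set L := take h s; set R := drop h s; set M := map (addn k) w.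
have le_s : all (leq^~ k) s by apply/allP => x /(perms_bounds Hs); lia.
have /andP[aL aR] : all (leq^~ k) L && all (leq^~ k) R.
  by rewrite -all_cat cat_take_drop.
have aM : all (fun x => k < x) M.
  by apply/allP => _ /mapP[x /(perms_bounds Hw) Hx ->]; lia.
have SL : size L = h by rewrite size_takel // (perms_size Hs).
have SM : size M = b by rewrite size_map (perms_size Hw).
have Ef : find (fun x => k < x) (L ++ M ++ R) = h.
  rewrite find_cat SL ifF; last first.
    by apply/negbTE/hasPn => x /(allP aL) /=; lia.
  by case: (M) SM aM => [|m M'] /= ; [lia | move=> _ /andP[-> _]; rewrite addn0].
have dM : pairwise (fun x y => ~~ (x < y)) w = pairwise (fun x y => ~~ (x < y)) M.
  by rewrite pairwise_map; apply: eq_pairwise => x y /=; rewrite ltn_add2l.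
rewrite /classA_top Ef eqxx andbT drop_size_cat //.
have -> : head 0 (L ++ M ++ R) <= k.
  by case: (L) SL aL => [|l L'] /=; [lia | move=> _ /andP[]].
have -> : pairwise (fun x y => ~~ (x <= k < y)) (M ++ R).
  apply/pairwise_subseqP => x y; rewrite -[M ++ R]cat0s; zone_cases.
  - by move: (all_subseq ZR aR); compare.
  - by move: (all_subseq ZM aM) (all_subseq ZR aR); compare.
  by move: (all_subseq ZM aM); compare.
have -> : pairwise (fun x y => ~~ (k < x < y)) (L ++ M ++ R) =
          pairwise (fun x y => ~~ (x < y)) M.
  apply/pairwise_subseqP/pairwise_subseqP => H x y.
    move=> Hxy; have :=
      H x y (subseq_trans Hxy (subseq_trans (prefix_subseq M R) (suffix_subseq L _))).
    by move: (all_subseq Hxy aM); compare.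
  zone_cases; move: (all_subseq ZL aL) (all_subseq ZM aM) (all_subseq ZR aR);
    try compare.
  by move: (H _ _ ZM); compare.
rewrite /= !andbT andbC -dM; case dw : (pairwise _ w) => //=; rewrite dM in dw.
case: M SM aM dw {Ef dM} => [|m M] SM aM dw; first by move: SM b0 => /= <-.
(* One lemma serves both ways: it shrinks the block to the letter k + 1 and expands this letter to
   the block. *)
apply/idP/idP; [apply: (@classA_dec_block k L m M [:: k + 1] R)
  | apply: (@classA_dec_block k L (k + 1) [::] (m :: M) R)] => //=;
  by rewrite addn1 ltnSn.
Qed.

(** Sorting by the position h of the block gives the terms with h > 0 of the count of Av(2134, 2413)
    in size k + 1 by the position of the maximum. The missing term h = 0 has the maximum in front
    and equals the count in size k. *)
Lemma num_classA_top k b : 0 < b ->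
  count (classA_top k) (perms (k + b)) + num_of_size classA k = num_of_size classA k.+1.
Proof.
move=> b0; rewrite (@count_fiber _ _ (find (fun x => k < x)) _ k.+1); last first.
  move=> s Hs _; have := find_count_le k s.
  by rewrite (perms_count_gt _ Hs) (perms_size Hs); lia.
rewrite num_classA_sum !big_ord_recl /= num_classA_at0 addnC; congr (_ + _).
rewrite (eq_in_count (a2 := pred0)) ?count_pred0 ?add0n.
  apply: eq_bigr => h _; rewrite num_classA_top_at // /bump /=.
  by have := ltn_ord h; lia.
case=> [|x s] Hs /=; first by have := perms_size Hs; rewrite /=; lia.
by rewrite /classA_top /=; case: (ltnP k x) => _; rewrite ?andbF.
Qed.

(** A least letter in front takes part in no 213, where the first letter has a smaller one after
    it. *)
Lemma num_classC_min i :
  count (fun w => classC w && (head 0 w == 1)) (perms i.+1) = num_of_size classC i.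
Proof.
have := @count_ins i 1 0 0 (fun w => classC w && (head 0 w == 1)) predT classC.
rewrite (addn1 i) mul1n; apply=> //.
  by move=> [|v s] Hs /=; [have := perms_size Hs | move=> /andP[_ /eqP->]; rewrite take0].
move=> w s; rewrite perms1 inE => /eqP-> Hs /=.
rewrite /ins take0 drop0 /= andbT /classC -(avoids_map s _ (shift_mono 0 1)).
have Hp : all (fun x => 1 < x) (map (shift 0 1) s).
  by apply/allP => _ /mapP[x /(perms_bounds Hs) Hx ->]; rewrite /shift; case: (leqP x 0); lia.
apply/idP/idP => [|/avoids213P C1]; first exact/avoids_subseq/subseq_cons.
apply/avoids213P => a b c /=; case: eqP => [->|_]; last exact: C1.
by move=> /all_subseq/(_ Hp) /=; lia.
Qed.

(** Otherwise v, x, d, y form a 2413. *)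
Lemma classA_big_gt v L d T x y : classA (v :: L ++ d :: T) -> d < v ->
  x \in L -> y \in T -> v < y -> x <= y.
Proof.
move=> /classAP[_ A2] lt_dv xL yT lt_vy.
have : subseq [:: v; x; d; y] (v :: L ++ d :: T).
  rewrite /= eqxx; have xL' : subseq [:: x] L by rewrite sub1seq.
  apply: (@cat_subseq _ [:: x] [:: d; y] L (d :: T) xL').
  by rewrite /= eqxx sub1seq.
by move=> /A2; lia.
Qed.

Lemma leq_in_count (T : eqType) (a b : pred T) s :
  {in s, subpred a b} -> count a s <= count b s.
Proof.
move=> Hab; rewrite (@eq_in_count _ a (predI a b)).
  by apply: sub_count => x /andP[].
by move=> x /Hab /=; case: (a x) => // /(_ isT).
Qed.

Lemma classA_top_shift k b s : classA_top k (map (shift k b) s) = classA_top k s.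
Proof.
have shiftE x : (k < shift k b x) = (k < x).
  by rewrite /shift; case: (leqP x k); lia.
rewrite /classA_top find_map -map_drop !pairwise_map; congr [&& _, _, _ & _].
- exact/all_avoids_map/shift_mono.
- by case: s => //= x s; rewrite leqNgt shiftE -leqNgt.
- by apply: eq_pairwise => x y /=; rewrite shiftE shift_mono.
rewrite (@eq_find _ _ (fun x => k < x)) => [|x /=]; last exact: shiftE.
by apply: eq_pairwise => x y /=; rewrite leqNgt shiftE -leqNgt shiftE.
Qed.

Lemma all_take_find (T : Type) (a : pred T) s : all (predC a) (take (find a s) s).
Proof. by elim: s => //= x s IH; case: ifP => //= ->. Qed.

Lemma classA_top_no_gap k T x y z : classA_top k T ->
  subseq [:: x; y; z] T -> ~~ [&& k < x, y <= k & k < z].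
Proof.
case/and4P => _ _ _ dT; have := all_take_find (fun x => k < x) T.
move: (find _ T) dT => f dT aT.
rewrite -{1}(cat_take_drop f T) -[drop f T]cats0; zone_cases;
  move: (all_subseq ZL aT) (subseq_pairwise ZM dT); compare.
Qed.

(** An ascent above k in the tail would form a 2134 with [k.+1] and d. Given this, a letter at most
    k between letters above k would complete a 2413 with [k.+1]. The gap up to K keeps the value
    [k.+1] itself out of the tail. *)
Lemma classA_topP k K L d T : uniq (d :: T) -> d <= k -> k < K ->
  all (fun x => (x <= k) || (K < x)) (d :: T) -> has (fun x => k < x) (d :: T) ->
  classA (k.+1 :: L ++ d :: T) -> classA_top k (d :: T).
Proof.
move=> UT le_dk lt_kK aT hT AT; have /classAP[A1 A2] := AT.
have suf : subseq (d :: T) (L ++ d :: T) by apply: suffix_subseq.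
have dT x y : subseq [:: x; y] (d :: T) -> ~~ (k < x < y).
  move=> Hxy; have := all_subseq Hxy aT; move: Hxy => /=.
  case: eqP => [->|_ Hxy]; first by lia.
  have : subseq [:: k.+1; d; x; y] (k.+1 :: L ++ d :: T).
    by rewrite /= eqxx; apply: subseq_trans suf; rewrite /= eqxx.
  by move/A1; lia.
apply/and4P; split => //.
- by apply: all_avoids_subseq AT; apply: subseq_trans suf (subseq_cons _ _).
- exact/pairwise_subseqP.
apply/pairwise_subseqP => x y; have := nth_find 0 hT; move: hT; rewrite has_find.
move: (find _ _) => f lt_f; rewrite (drop_nth 0 lt_f).
have := mem_nth 0 lt_f; have := cat_take_drop f (d :: T); rewrite (drop_nth 0 lt_f).
move: (nth _ _ _) (drop f.+1 _) => u D ED uT lt_ku Hxy.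
have sub : subseq (u :: D) (d :: T) by rewrite -ED suffix_subseq.
have UD : uniq (u :: D) := subseq_uniq sub UT.
have := all_subseq (subseq_trans Hxy sub) aT; move: Hxy => /=.
case: eqP => [->|_ Hxy]; first by lia.
have yD : y \in D by apply: (mem_subseq Hxy); rewrite !inE eqxx orbT.
have lt_yu : y != u by move: UD => /= /andP[uD _]; apply: contraNneq uD => <-.
have : subseq [:: k.+1; u; x; y] (k.+1 :: L ++ d :: T).
  rewrite /= eqxx; apply: subseq_trans suf; apply: subseq_trans sub.
  by rewrite /= eqxx.
have : subseq [:: u; y] (d :: T).
  by apply: subseq_trans sub; rewrite /= eqxx sub1seq.
by move=> /dT ? /A2; lia.
Qed.

(* The block v alpha has size i.+1 and values k.+1, ..., k + i.+1. *)
Lemma num_classA_split (m i k : nat) : k < m ->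
  count (fun s => (classA s && (blk 1 s == i)) &&
                  (m - count (fun x => head 0 s < x) (drop i.+1 s) == k))
    (perms (m + i.+1)) =
  num_of_size classC i * count (classA_top k) (perms m).
Proof.
(* As v is the least letter of its block, v alpha is counted as a 213-avoider of size i + 1 that
   begins with 1. *)
move=> lt_km; rewrite -num_classC_min; apply: (@count_ins m i.+1 0 k) => //.
- exact: ltnW.
- case=> [|v s] Hs; first by have := perms_size Hs; rewrite /=; lia.
  have Ss : size s = m + i by have := perms_size Hs; rewrite /=; lia.
  have Us := perms_uniq Hs; have Cs x := perms_count_gt x Hs.
  rewrite drop0 /blk /= drop0 => /andP[/andP[As /eqP Hb] /eqP Hk].
  set L := take i s; have SL : size L = i by rewrite size_takel // Ss leq_addl.
  have ST : size (drop i s) = m by rewrite size_drop Ss addnK.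
  case ET: (drop i s) ST => [|d T] ST; first by move: ST lt_km => /= <-.
  have Es : s = L ++ d :: T by rewrite -ET cat_take_drop.
  have lt_dv : d < v.
    have -> : d = nth 0 s i by rewrite Es nth_cat SL ltnn subnn.
    rewrite -{1}Hb; apply: (@nth_find _ 0 (fun x => x < v)).
    by rewrite has_find Hb Ss; lia.
  have vL : all (fun x => v < x) L.
    apply/(all_nthP 0) => j; rewrite SL => Hj.
    have Hv : nth 0 L j != v.
      by apply: contraTneq Us => <-; rewrite cons_uniq Es mem_cat mem_nth ?SL.
    have := before_find 0 (a := fun x => x < v) (s := s) (i := j).
    by rewrite Hb Hj -(nth_take _ Hj) -/L => /(_ isT); lia.
  have LT x : x \in L -> x \notin T.
    move=> xL; move: Us; rewrite /= Es cat_uniq => /and4P[_ _ /hasPn H _].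
    by apply: contraL xL => xT; apply: H; rewrite inE xT orbT.
  rewrite ET in Hk.
  (* The letters after the block that exceed v number m - k and exceed the whole block, by
     [classA_big_gt]. This bounds the letters of the block by k + i + 1. *)
  have big_le x : x \in v :: L -> count (fun y => v < y) (d :: T) <= count (fun y => x < y) (v :: s).
    move=> Hx; apply: (@leq_trans (count (fun y => x < y) (d :: T))).
      apply: leq_in_count => y; rewrite !inE => /orP[/eqP->|yT] lt_vy; first by lia.
      move: Hx; rewrite inE => /orP[/eqP->//|xL].
      have le_xy : x <= y.
        by rewrite Es in As; apply: classA_big_gt As lt_dv xL yT lt_vy.
      rewrite ltn_neqAle le_xy andbT; apply: contraNneq (LT x xL) => ->//.
    by rewrite /= Es count_cat /=; lia.
  (* Exactly i + (m - k) letters exceed v: those of L and the m - k large ones after it. *)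
  have Ev : v = k.+1.
    have := Cs v; rewrite /= ltnn add0n Es count_cat.
    have -> : count (fun x => v < x) L = i by rewrite -SL; apply/eqP; rewrite -all_count.
    have := perms_bounds Hs (mem_head v s).
    by have := count_size (fun x => v < x) (d :: T); rewrite ST; lia.
  have HvL x : x \in v :: L -> k < x <= k + i.+1.
    move=> Hx; have := big_le x Hx; rewrite Cs => Hc.
    apply/andP; split; first by move: Hx; rewrite Ev inE => /orP[/eqP->//|/(allP vL)]; rewrite Ev /=; lia.
    have : x <= m + i.+1.
      apply: (andP (perms_bounds Hs _)).2; move: Hx; rewrite !inE Es mem_cat.
      by case/orP => ->; rewrite ?orbT.
    by have := count_size (fun x => v < x) (d :: T); rewrite ST; lia.
  have : all (fun x => k < x <= k + i.+1) (v :: L) by apply/allP.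
  by rewrite /=.
move=> w s Hw Hs; rewrite /ins take0 drop0 cat0s (perms_size Hw).
set V := map (addn k) w; set T := map (shift k i.+1) s.
have sz_V : size V = i.+1 by rewrite size_map (perms_size Hw).
have aV : all (fun x => k < x <= k + i.+1) V.
  by apply/allP => _ /mapP[x /(perms_bounds Hw) Hx ->]; lia.
have aT : all (fun x => (x <= k) || (k + i.+1 < x)) T.
  by apply/allP => _ /mapP[x Hx ->]; rewrite /shift; case: (leqP x k); lia.
have TA : classA T = classA s by apply/all_avoids_map/shift_mono.
have VC : classC V = classC w by apply/avoids_map/addn_mono.
have shiftE x : (k < shift k i.+1 x) = (k < x).
  by rewrite /shift; case: (leqP x k); clear; lia.
have cT : count (fun x => k < x) T = m - k.
  by rewrite count_map -(perms_count_gt k Hs); apply: eq_count => x /=.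
have w1 : 1 \in w by rewrite (perms_mem _ Hw).
case Ew : w Hw w1 => [|z w'] Hw w1; first by have := perms_size Hw.
have /andP[z0 _] := perms_bounds Hw (mem_head z w').
have {sz_V} sz_V : size (map (addn k) w') = i.
  by rewrite size_map; have := perms_size Hw => -[].
have EV : V = (k + z) :: map (addn k) w' by rewrite /V Ew.
have sz_VT : size V = i.+1 by rewrite EV /= sz_V.
have hT : has (fun x => k < x) T by rewrite has_count cT subn_gt0.
have [x xT lt_kx] := hasP hT.
have lt_Kx : k + i.+1 < x by have := allP aT x xT; rewrite leqNgt lt_kx.
have UT : uniq T by rewrite (map_inj_uniq (@shift_inj _ _)) (perms_uniq Hs).
have Eblk : blk 1 (V ++ T) = find (fun y => y < k + z) (map (addn k) w' ++ T).
  by rewrite EV /blk /= drop0.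
have Ehd : head 0 (V ++ T) = k + z by rewrite EV.
rewrite -/V -/T -(classA_top_shift k i.+1) -/T -{1}Ew -VC [head 0 (z :: w')]/=.
rewrite Eblk Ehd drop_size_cat //.
have w'L : z != 1 -> k.+1 \in map (addn k) w'.
  move=> z_neq1; rewrite -addn1 map_f //.
  by move: w1; rewrite inE eq_sym (negPf z_neq1).
move: (map _ w') sz_V EV w'L {Eblk Ehd TA VC} => L sz_V EV w'L.
have vL : z = 1 -> has (fun y => y < k + z) L = false.
  move=> z1; apply/hasPn => y yL; rewrite z1 addn1 -leqNgt.
  by have := allP aV y; rewrite EV inE yL orbT => /(_ isT) /andP[].
apply/idP/idP => [/andP[/andP[AT /eqP Hf] _]|/andP[/andP[CV /eqP z1] tT]]; last first.
  have /and4P[At ht dT _] := tT.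
  rewrite (classA_glue aV aT dT _ CV At) ?andTb; last first.
    by move=> x1 x2 x3; apply: classA_top_no_gap.
  have -> : count (fun y => k + z < y) T = m - k.
    rewrite -cT; apply: eq_in_count => y yT /=.
    by move: (allP aT y yT); rewrite z1 /=; clear; lia.
  rewrite find_cat (vL z1) sz_V z1 addn1; apply/andP; split; last by rewrite subKn // ltnW.
  by case: (T) ht xT => //= d T'; rewrite ltnS => ->; rewrite addn0.
(* Otherwise the value k + 1 occurs in L below the first letter k + z, and the run ends before
   length i. *)
have z1 : z = 1.
  apply/eqP; apply: contraT => z_neq1.
  have hL : has (fun y => y < k + z) L.
    by apply/hasP; exists k.+1; [apply: w'L | clear -z_neq1 z0; lia].
  by move: Hf; rewrite find_cat hL => Hf; move: hL; rewrite has_find Hf sz_V ltnn.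
have vL1 := vL z1; rewrite z1 in EV Hf vL1 *; rewrite eqxx andbT.
rewrite EV in aV.
move: Hf AT; rewrite find_cat vL1 sz_V EV => Hf AT; apply/andP; split.
  (* A 213 in the block followed by the larger letter x of T would be a 2134. *)
  apply/avoids213P => a b c Habc; have /classAP[A1 _] := AT.
  have Hx : subseq [:: x] T by rewrite sub1seq.
  have := A1 a b c x; rewrite (cat_subseq Habc Hx) => /(_ isT).
  by move: (all_subseq Habc aV) lt_Kx; clear; rewrite /=; lia.
case: (T) UT aT hT Hf AT => [|d T'] //= UT' aT' hT' Hf AT.
have lt_d : d < k + 1 by move: Hf; case: ltnP => // _; clear; lia.
apply: (@classA_topP k (k + i.+1) L d T') => //; last by move: AT; rewrite addn1.
  by move: lt_d; rewrite addn1.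
by rewrite addnS ltnS leq_addr.
Qed.

Lemma avoids_nil x p : avoids [::] (x :: p).
Proof. by apply/avoidsP => t; rewrite subseq0 => /eqP->. Qed.

Lemma num_of_size0 (P : pred (seq nat)) : num_of_size P 0 = P [::].
Proof. by rewrite /num_of_size /= addn0. Qed.

(** By [num_classA_top] with b = m - k, the term of index k is the difference of the counts in sizes
    k + 1 and k; the count in size 0 is 1. *)
Lemma num_classA_telescope m :
  \sum_(k < m) count (classA_top k) (perms m) + 1 = num_of_size classA m.
Proof.
suff H p : p <= m -> \sum_(k < p) count (classA_top k) (perms m) + 1 = num_of_size classA p.
  exact: H.
elim: p => [_|p IH lt_pm]; first by rewrite big_ord0 num_of_size0 /classA /= !avoids_nil.
rewrite big_ord_recr /= -addnA addnCA addnC IH ?(ltnW lt_pm) // addnC.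
have := @num_classA_top p (m - p); rewrite subnKC ?(ltnW lt_pm) //.
by apply; rewrite subn_gt0.
Qed.

Lemma num_classA_gt0 m : 0 < num_of_size classA m.
Proof. by rewrite -num_classA_telescope addn1. Qed.

(** Here i is the length of the run of larger letters after the first letter v. The first summand
    counts the skew sums, where nothing after the run exceeds v; the second counts the other form,
    summed over the number k of smaller letters by telescoping. *)
Lemma num_classA_rec n :
  num_of_size classA n.+1 =
    \sum_(i < n.+1) (num_of_size classA i * num_of_size classA (n - i)
                     + num_of_size classC i * (num_of_size classA (n - i) - 1)).
Proof.
rewrite {1}/num_of_size (@count_fiber _ _ (blk 1) _ n.+1) => [|s Hs _]; last first.
  by have := blk_size 1 s; rewrite (perms_size Hs); lia.
apply: eq_bigr => i _; have Hi : i <= n by rewrite -ltnS.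
move: (nat_of_ord i) Hi => {}i Hi.
set big := fun s : seq nat => count (fun x => head 0 s < x) (drop i.+1 s).
rewrite (@count_fiber _ _ (fun s => n - i - big s) _ (n - i).+1) => [|s _ _]; last first.
  by rewrite ltnS leq_subr.
(* The last index k = n - i says that no later letter exceeds v, which is the skew sum case. *)
rewrite big_ord_recr /= addnC -[1 :: iota 2 n]/(iota 1 n.+1); congr (_ + _); last first.
  rewrite -num_classA_telescope addnK big_distrr /=; apply: eq_bigr => k _.
  by rewrite -num_classA_split // addnS subnK.
have Es : n.+1 = (n - i).+1 + i by rewrite addSn subnK.
pose P s := classA s && (n - i - big s == n - i).
rewrite (@eq_count _ _ (fun s => P s && (blk 1 s == i))) => [|s]; last first.
  by rewrite andbAC.
rewrite {1}Es (@count_blk _ _ 0 P classA (fun s => classA s && all (fun x => x < head 0 s) (behead s))) //.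
- congr (_ * _); apply: count_blk0_max => [v s Hs /andP[]//|s Hs Hn].
  by rewrite /= Hn andbT; apply: all_avoids_max_cons.
- move=> v [|//] M T Hs _ SM vM _ /andP[_]; rewrite /big /= -SM drop_size_cat //.
  move=> cT m x mM xT; apply: leq_ltn_trans (allP vM m mM); move: cT xT.
  have := count_size (fun x => v < x) T; have := perms_size Hs.
  rewrite /= size_cat SM => ST le_cT Hc; have {Hc} : count (fun x => v < x) T == 0.
    by move: ST le_cT Hc; clear; lia.
  by rewrite -leqn0 leqNgt -has_count => /hasPn H /H; rewrite -leqNgt.
- by move=> w; apply/all_avoids_map/addn_mono.
move=> v [|//] M T Hs _ SM _ /andP[le_v _] aM _; rewrite /P /big /= -SM drop_size_cat //.
rewrite SM; have -> : (n - i - count (fun x => v < x) T == n - i) =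
    all (fun x => x < v) T.
  have := count_size (fun x => v < x) T; have := perms_size Hs => /= -[-> le_cT].
  have -> : (n - i - count (fun x => v < x) T == n - i) = ~~ has (fun x => v < x) T.
    by rewrite has_count; move: le_cT; clear; lia.
  apply/hasPn/idP => [nT|/allP aT x /aT /=]; last by rewrite -leqNgt; apply: ltnW.
  by apply: perms_all_lt Hs _ => x /nT; rewrite -leqNgt.
case aT : (all _ T); rewrite ?andbF // !andbT.
exact: classA_head_block le_v aM aT.
Qed.

(** * Av(2413, 1324, 2314, 3124) *)

(** For n at most h both sides vanish: R requires more than h letters, and a block of size b after h
    + 1 letters does not fit. *)
Lemma count_blk_sized n b h (P Q R : pred (seq nat)) :
    (forall s : seq nat, P s -> h < size s) -> (forall s : seq nat, R s -> h < size s) ->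
    (forall (v : nat) (L M T : seq nat), v :: L ++ M ++ T \in perms (n + b) -> size L = h ->
       size M = b -> all (fun x => v < x) M -> head 0 T < v ->
       P (v :: L ++ M ++ T) -> forall m x : nat, m \in M -> x \in L ++ T -> x < m) ->
    (forall w, Q (map (addn n) w) = Q w) ->
    (forall (v : nat) (L M T : seq nat), v :: L ++ T \in perms n -> size L = h -> size M = b ->
       head 0 T < v -> all (leq^~ n) (v :: L) -> all (fun x => n < x) M -> all (leq^~ n) T ->
       P (v :: L ++ M ++ T) = Q M && R (v :: L ++ T)) ->
  count (fun s => P s && (blk h.+1 s == b)) (perms (n + b)) =
    count Q (perms b) * count (fun s => R s && (blk h.+1 s == 0)) (perms n).
Proof.
move=> sP sR H1 HQ H2; case: (ltnP h n) => [lt_hn|le_nh]; first exact: count_blk.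
rewrite (eq_in_count (a2 := pred0)) => [|s Hs]; last first.
  apply/negP => /= /andP[/sP]; have := blk_size h.+1 s; rewrite (perms_size Hs).
  by move: le_nh; clear; lia.
rewrite [X in _ * X](eq_in_count (a2 := pred0)) ?count_pred0 ?muln0 // => s Hs.
by apply/negP => /= /andP[/sR]; rewrite (perms_size Hs) ltnNge le_nh.
Qed.

(** The members of E that accept a block of larger letters from Av(213) after their first h letters,
    by [classE_block]. *)
Definition classF (h : nat) (s : seq nat) : bool :=
  [&& h <= size s, pairwise (fun x y => y < x) (take h s),
      across (take h s) (drop h s) & classE s].

Definition head_is_max (s : seq nat) : bool := all (fun x => x < head 0 s) (behead s).

Lemma classF_cons v L T : classF (size L).+1 (v :: L ++ T) =
  [&& pairwise (fun x y => y < x) (v :: L), across (v :: L) T & classE (v :: L ++ T)].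
Proof.
rewrite /classF /= ltnS size_cat leq_addr /=.
by rewrite take_size_cat // drop_size_cat.
Qed.

Lemma classF_tail v L T x : classF (size L).+1 (v :: L ++ T) -> head 0 T < v ->
  x \in L ++ T -> x <= v.
Proof.
rewrite classF_cons mem_cat => /and3P[/= /andP[dL _] /andP[aT _] _] Hh.
case/orP => [/(allP dL)/ltnW//|]; case: T Hh aT => //= t T lt_tv /andP[aT _].
rewrite inE => /orP[/eqP->|/(allP aT)]; first exact: ltnW.
by rewrite lt_tv -leqNgt.
Qed.

(** A letter of M is never below d, so it can only be the z of a forbidden pair, and then y would
    precede it in M. *)
Lemma across_block n L M T :
  all (leq^~ n) L -> all (fun x => n < x) M -> all (leq^~ n) T ->
  across L (M ++ T) = across L T.
Proof.
move=> aL aM aT; apply: eq_in_all => d dL.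
apply/pairwise_subseqP/pairwise_subseqP => H y z.
  by move=> Hyz; apply: H; apply: subseq_trans Hyz (suffix_subseq _ _).
have dn := allP aL d dL; rewrite -[M ++ T]cat0s; zone_cases.
- exact: (H _ _ ZR).
- by move: dn (all_subseq ZM aM) (all_subseq ZR aT); compare.
by move: dn (all_subseq ZM aM); compare.
Qed.

(** M has to avoid 213, because the smaller letter v in front would turn a 213 into a 1324. *)
Lemma classF_block n v L M T :
  all (leq^~ n) (v :: L) -> all (fun x => n < x) M -> all (leq^~ n) T ->
  classF (size L).+1 (v :: L ++ M ++ T) = classC M && classF (size L).+1 (v :: L ++ T).
Proof.
move=> aL aM aT; rewrite !classF_cons.
rewrite (across_block aL aM aT).
case dL: (pairwise _ _); rewrite ?andFb ?andbF // !andTb.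
case LT: (across _ T); rewrite ?andFb ?andbF // !andTb.
apply/idP/andP => [H|[HM HT]]; last exact: (@classE_block n (v :: L)).
split; last first.
  by apply: all_avoids_subseq H; rewrite /= eqxx cat_subseq // suffix_subseq.
have /classEP[_ E2 _ _] := H; apply/avoids213P => a b c Habc.
have : subseq [:: v; a; b; c] (v :: L ++ M ++ T).
  rewrite /= eqxx; apply: subseq_trans Habc _.
  exact: (subseq_trans (prefix_subseq _ T) (suffix_subseq L _)).
move=> /E2; move: (all_subseq Habc aM) (allP aL v (mem_head v L)); clear.
by rewrite /=; lia.
Qed.

Lemma blk_head_max h s : head_is_max s -> h < size s -> blk h.+1 s = 0.
Proof. by case: s => //= v s; rewrite /head_is_max /= => /(@blk_max_first h). Qed.

Lemma num_classF_rec n h :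
  num_of_size (classF h.+1) n = \sum_(b < n.+1)
    num_of_size classC b * num_of_size (fun s => classF h.+1 s && head_is_max s) (n - b).
Proof.
rewrite {1}/num_of_size (@count_fiber _ _ (blk h.+1) _ n.+1) => [|s Hs _]; last first.
  by have := blk_size h.+1 s; rewrite (perms_size Hs); lia.
apply: eq_bigr => b _; have Hb : b <= n by rewrite -ltnS.
move: (nat_of_ord b) Hb => {}b Hb.
rewrite -{1}(subnK Hb) (@count_blk_sized _ _ h _ classC (classF h.+1)).
- congr (_ * _); apply: eq_in_count => s Hs /=; case Fs: (classF _ _) => //=.
  have lt_hs : h < size s by move: Fs => /andP[].
  apply/eqP/idP => [|/blk_head_max ->//].
  case: s Hs Fs lt_hs => //= v s Hs Fs lt_hs H0.
  have v0 : 0 < v by have := perms_bounds Hs (mem_head v s); case: (v).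
  apply: perms_all_lt Hs _ => x; rewrite -(cat_take_drop h s).
  have sz_h : size (take h s) = h by rewrite size_takel.
  apply: classF_tail; first by rewrite sz_h cat_take_drop.
  by move: H0; rewrite /blk /=; case: (drop h s) => //= t T; case: (t < v).
- by move=> s /andP[].
- by move=> s /andP[].
- move=> v L M T Hs <- SM vM vT Fs m x mM xLT.
  have xMT : x \in L ++ M ++ T.
    by move: xLT; rewrite !mem_cat => /orP[->|->]; rewrite ?orbT.
  apply: leq_ltn_trans (allP vM m mM).
  have [xL|xT] := orP (etrans (esym (mem_cat x L T)) xLT).
    move: Fs; rewrite classF_cons => /and3P[/= /andP[dL _] _ _].
    by have := allP dL x xL => /ltnW.
  move: Fs; rewrite classF_cons => /and3P[_ /andP[aT _] _].
  case: T vT xT aT {Hs xLT xMT} => //= t T vT; rewrite inE => /orP[/eqP-> _|xT].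
    exact: ltnW.
  rewrite pairwise_cat => /and3P[_ _ /= /andP[aT _]].
  by have := allP aT x xT; rewrite vT -leqNgt.
- by move=> w; apply/avoids_map/addn_mono.
move=> v L M T _ <- _ _ aL aM aT; exact: (classF_block aL aM aT).
Qed.

Definition classF_max (h : nat) (s : seq nat) : bool := classF h s && head_is_max s.

(** The maximum in front takes part in no pattern and no [across] condition, so it can be
    removed. *)
Lemma num_classF_max h n :
  num_of_size (classF_max h.+1) n.+1 = num_of_size (classF h) n.
Proof.
apply: count_max_first => [[|v s] Hs|s Hs]; first by have := perms_size Hs.
  by case/andP => _; apply: head_max.
have Hn : all (fun x => x < n.+1) s by apply/allP => x /(perms_bounds Hs); lia.
rewrite /classF_max /head_is_max /= Hn andbT /classF /= ltnS.
have -> : all (fun x => x < n.+1) (take h s).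
  by apply/allP => x /mem_take/(allP Hn).
have -> : pairwise (fun y z => ~~ (y < n.+1 < z)) (drop h s).
  apply/pairwise_subseqP => y z /mem_subseq/(_ z); rewrite !inE eqxx orbT.
  by move=> /(_ isT)/mem_drop/(allP Hn) /=; lia.
by rewrite /classE all_avoids_max_cons.
Qed.

Lemma num_classF_small h n : n < h -> num_of_size (classF h) n = 0.
Proof.
move=> lt_nh; apply/eqP; rewrite -leqn0 leqNgt -has_count; apply/hasPn => s Hs.
by rewrite /classF (perms_size Hs) leqNgt lt_nh.
Qed.

Lemma num_classF_max_small h n : n < h -> num_of_size (classF_max h) n = 0.
Proof.
move=> lt_nh; apply/eqP; rewrite -leqn0 -(num_classF_small lt_nh).
by apply: sub_count => s /andP[].
Qed.

Lemma num_classF0 n : num_of_size (classF 0) n = num_of_size classE n.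
Proof. by apply: eq_count => s; rewrite /classF take0. Qed.

(** If x exceeded v, then v, m, the first letter of T and x would form a 2413 or a 2314, according
    to whether x is below or above m. *)
Lemma classE_head_tail v L M T m x : x != v -> x != m ->
  classE (v :: L ++ M ++ T) -> head 0 T < v -> m \in M -> v < m -> x \in T -> x < v.
Proof.
move=> xv xm /classEP[E1 _ E3 _]; case: T E1 E3 => // t T E1 E3 /= lt_tv mM lt_vm.
rewrite inE => /orP[/eqP->//|xT]; rewrite ltnNge; apply/negP => le_vx.
have sub : subseq [:: v; m; t; x] (v :: L ++ M ++ t :: T).
  rewrite /= eqxx; apply: subseq_trans (suffix_subseq L _).
  have mM' : subseq [:: m] M by rewrite sub1seq.
  by apply: (@cat_subseq _ [:: m] [:: t; x] M (t :: T) mM'); rewrite /= eqxx sub1seq.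
by move: xv xm (E1 _ _ _ _ sub) (E3 _ _ _ _ sub) le_vx lt_vm lt_tv; clear; lia.
Qed.

(** An ascent x, y in L would give the 3124 formed by v, x, y, m. A pair y, z in T around d in L
    would give the 2413 formed by d, m, y, z. *)
Lemma classE_classF v L M T m : uniq L -> m \in M ->
  all (fun x => x < m) (v :: L ++ T) -> all (fun x => x < v) (L ++ T) ->
  classE (v :: L ++ M ++ T) -> classF (size L).+1 (v :: L ++ T).
Proof.
move=> U mM /allP lt_m /allP lt_v HE; have /classEP[E1 _ _ E4] := HE.
have Zm : subseq [:: m] M by rewrite sub1seq.
have subLT : subseq (v :: L ++ T) (v :: L ++ M ++ T).
  by rewrite /= eqxx cat_subseq // suffix_subseq.
rewrite classF_cons; apply/and3P; split; last exact: all_avoids_subseq HE.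
  apply/andP; split; first by apply/allP => x xL; apply: lt_v; rewrite mem_cat xL.
  apply/pairwise_subseqP => x y Hxy.
  have [xL yL] : x \in L /\ y \in L.
    by have /mem_subseq S := Hxy; split; apply: S; rewrite !inE eqxx ?orbT.
  have sub : subseq [:: v; x; y; m] (v :: L ++ M ++ T).
    rewrite /= eqxx; apply: (cat_subseq (s1 := [:: x; y]) Hxy).
    exact: subseq_trans Zm (prefix_subseq _ _).
  have := subseq_uniq Hxy U; rewrite /= inE andbT.
  have := lt_v y; rewrite mem_cat yL => /(_ isT).
  by move: (E4 _ _ _ _ sub) (lt_m v (mem_head _ _)); clear; lia.
apply/allP => d dL; apply/pairwise_subseqP => y z Hyz.
have [yT zT] : y \in T /\ z \in T.
  by have /mem_subseq S := Hyz; split; apply: S; rewrite !inE eqxx ?orbT.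
have lt_zv : z < v by apply: lt_v; rewrite mem_cat zT orbT.
have lt_zm : z < m by apply: lt_m; rewrite inE mem_cat zT !orbT.
move: dL; rewrite inE => /orP[/eqP->|dL]; first by move: lt_zv; clear; lia.
have sub : subseq [:: d; m; y; z] (v :: L ++ M ++ T).
  apply: subseq_trans (subseq_cons _ v).
  have Zd : subseq [:: d] L by rewrite sub1seq.
  apply: (@cat_subseq _ [:: d] [:: m; y; z] _ _ Zd).
  exact: (@cat_subseq _ [:: m] [:: y; z] _ _ Zm Hyz).
by move: (E1 _ _ _ _ sub) lt_zm; clear; lia.
Qed.

(** The first letter above the head stands at position h + 1 and starts a nonempty block. Without
    the block the head is the maximum, and [classE_classF] applies to the rest. *)
Lemma num_classE_block n b h :
  count (fun s => [&& classE s, has (fun x => head 0 s < x) s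
                    & find (fun x => head 0 s < x) s == h.+1] && (blk h.+1 s == b.+1))
    (perms (n + b.+1)) =
  num_of_size classC b.+1 * num_of_size (classF_max h.+1) n.
Proof.
rewrite (@count_blk_sized _ _ h _ classC (classF_max h.+1)).
- congr (_ * _); apply: eq_count => s /=; case Fs: (classF_max _ _) => //=.
  by move: Fs => /andP[/andP[lt_hs _] Ms]; rewrite blk_head_max.
- move=> s /and3P[_ Hs /eqP Hf]; rewrite has_find Hf in Hs.
  exact: ltnW.
- by move=> s /andP[/andP[]].
- move=> v L M T Hs SL SM vM vT /and3P[Es _ /eqP Hf] m x mM.
  rewrite mem_cat => /orP[xL|xT]; last first.
    apply: ltn_trans (allP vM m mM).
    have := perms_uniq Hs; rewrite /= !mem_cat !cat_uniq !negb_or.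
    case/and5P => [/and3P[_ _ vT'] _ _ _ /andP[/hasPn MT _]].
    apply: (classE_head_tail _ _ Es vT mM (allP vM m mM) xT).
      by apply: contraNneq vT' => <-.
    by apply: contraTneq mM => <-; apply: MT.
  apply: leq_ltn_trans (allP vM m mM).
  have := all_take_find (fun x => v < x) (v :: L ++ M ++ T).
  rewrite Hf -SL /= take_size_cat // => /andP[_ /allP/(_ x xL)] /=.
  by rewrite -leqNgt.
- by move=> w; apply/avoids_map/addn_mono.
move=> v L M T Hs SL SM vT aL aM aT; rewrite -SL /=.
rewrite ltnn /= eqSS; have le_v : v <= n := allP aL v (mem_head v L).
have vM : all (fun x => v < x) M by apply/allP => x /(allP aM); apply: leq_ltn_trans.
have [m [M' EM]] : exists m M', M = m :: M' by case: (M) SM => // m M' _; exists m, M'.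
have mM : m \in M by rewrite EM mem_head.
have -> : has (fun x => v < x) (L ++ M ++ T).
  by apply/hasP; exists m; rewrite ?mem_cat ?mM ?orbT //; apply: (allP vM).
rewrite /= find_cat; have -> : find (fun x => v < x) (M ++ T) = 0.
  by move: vM; rewrite EM /= => /andP[->].
rewrite addn0 has_find.
have -> : ((if find (fun x => v < x) L < size L then find (fun x => v < x) L else size L)
    == size L) = all (fun x => x <= v) L.
  rewrite -has_find; case: ifP => hL.
    rewrite ltn_eqF -?has_find //; apply/esym/negbTE/allPn.
    by have [x xL lt_vx] := hasP hL; exists x; rewrite // -ltnNge.
  by rewrite eqxx; apply/esym/allP => x xL; rewrite leqNgt; apply/hasPn: x xL; rewrite hL.
rewrite /classF_max andbA -(classF_block aL aM aT) /head_is_max /= all_cat.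
have LT_m x : x \in v :: L ++ T -> x < m.
  have aLT : all (leq^~ n) (v :: L ++ T) by rewrite -cat_cons all_cat aL aT.
  by move=> /(allP aLT)/leq_ltn_trans; apply; apply: (allP aM).
apply/andP/andP => [[HE Lv]|[HF /andP[Lv Tv]]]; last first.
  by move: HF; rewrite classF_cons => /and3P[_ _ ->]; split=> //; apply: sub_all Lv => x /ltnW.
have := perms_uniq Hs; rewrite /= mem_cat negb_or cat_uniq.
case/andP => /andP[vL' vT'] /and3P[UL _ _].
have Lv' : all (fun x => x < v) L.
  apply/allP => x xL; rewrite ltn_neqAle (allP Lv) // andbT.
  by apply: contraNneq vL' => <-.
have Tv : all (fun x => x < v) T.
  apply/allP => x xT; apply: (classE_head_tail _ _ HE vT mM (allP vM m mM) xT).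
    by apply: contraNneq vT' => <-.
  by rewrite ltn_eqF // LT_m // inE mem_cat xT !orbT.
rewrite Lv' Tv; split=> //.
have := classE_classF UL mM _ _ HE; rewrite all_cat Lv' Tv => F.
have /F/(_ isT) : all (fun x => x < m) (v :: L ++ T) by apply/allP.
by rewrite !classF_cons (across_block aL aM aT) HE => /and3P[-> -> _].
Qed.

Lemma count_split (T : Type) (a b : pred T) s :
  count a s = count (fun x => a x && b x) s + count (fun x => a x && ~~ b x) s.
Proof. by elim: s => //= x s ->; case: (a x); case: (b x); rewrite //= addnACA. Qed.

(** Either the first letter is the maximum, or h + 1 is the position of the first letter above it
    and b + 1 the size of the block there. The bound N keeps the range of h independent of n, as the
    generating functions require. *)
Lemma num_classE_rec N n : n <= N ->
  num_of_size classE n.+1 = num_of_size classE n +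
    \sum_(h < N) \sum_(b < n.+1)
      num_of_size classC b.+1 * num_of_size (classF_max h.+1) (n - b).
Proof.
move=> le_nN.
rewrite {1}/num_of_size (count_split _ (fun s => ~~ has (fun x => head 0 s < x) s)).
congr (_ + _).
  apply: count_max_first => [[|v s] Hs|s Hs /=]; first by have := perms_size Hs.
    case/andP => _ /= /norP[_ /hasPn Hv]; apply: (head_max Hs); apply: perms_all_lt Hs _.
    by move=> x /Hv; rewrite -leqNgt.
  have Hn : all (fun x => x < n.+1) s by apply/allP => x /(perms_bounds Hs); lia.
  rewrite ltnn (_ : has _ s = false) ?andbT ?/classE ?all_avoids_max_cons //.
  by apply/hasPn => x /(allP Hn); rewrite -leqNgt => /ltnW.
rewrite (eq_count (a2 := fun s => classE s && has (fun x => head 0 s < x) s)); last first.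
  by move=> s; rewrite negbK.
rewrite (@count_fiber _ _ (fun s => find (fun x => head 0 s < x) s) _ N.+1); last first.
  move=> s Hs /andP[_]; rewrite has_find (perms_size Hs) => /leq_trans; apply.
  by rewrite ltnS.
rewrite big_ord_recl (eq_count (a2 := pred0)) ?count_pred0 ?add0n; last first.
  by case=> [|v s] /=; rewrite ?ltnn ?andbF.
apply: eq_bigr => h _; rewrite (_ : nat_of_ord (lift ord0 h) = h.+1) //.
move: (nat_of_ord h) => {}h.
rewrite (@count_fiber _ _ (blk h.+1) _ n.+2) => [|s Hs _]; last first.
  by have := blk_size h.+1 s; rewrite (perms_size Hs); lia.
rewrite big_ord_recl (eq_count (a2 := pred0)) ?count_pred0 ?add0n; last first.
  move=> s /=; apply/negP => /andP[/andP[/andP[_ Hh] /eqP Hf] /eqP].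
  have := nth_find 0 Hh; rewrite Hf /blk; move: Hh; rewrite has_find Hf => lt_hs.
  by rewrite (drop_nth 0 lt_hs) /=; case: (ltnP _ (head 0 s)) => // /ltn_trans H /H; rewrite ltnn.
apply: eq_bigr => b _; rewrite (_ : nat_of_ord (lift ord0 b) = b.+1) //.
have Hb : b <= n by rewrite -ltnS.
move: (nat_of_ord b) Hb => {}b Hb.
rewrite -num_classE_block addnS subnK //.
by apply: eq_count => s /=; rewrite !andbA.
Qed.

(** * Av(2314, 3124, 13524, 12435) *)

(** As L decreases, an occurrence that meets M lies in M except perhaps for its first letter.
    Without that letter, 13524 and 12435 become 2413 and 1324, which E excludes. *)
Lemma classB_block n L M R :
  all (leq^~ n) L -> all (fun x => n < x) M -> all (leq^~ n) R ->
  pairwise (fun x y => y < x) L ->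
  classB (L ++ R) -> classE M -> classB (L ++ M ++ R).
Proof.
move=> aL aM aR dL /classBP[B1 B2 B3 B4] /classEP[E1 E2 E3 E4].
apply/classBP; split;
  [move=> a b c d | move=> a b c d | move=> a b c d e | move=> a b c d e]; zone_cases;
  move: (all_subseq ZL aL) (all_subseq ZM aM) (all_subseq ZR aR) (subseq_pairwise ZL dL);
  try compare; move=> _ _ _ _.
all: first
  [ exact: (B1 _ _ _ _ (cat_subseq ZL ZR)) | exact: (B2 _ _ _ _ (cat_subseq ZL ZR))
  | exact: (B3 _ _ _ _ _ (cat_subseq ZL ZR)) | exact: (B4 _ _ _ _ _ (cat_subseq ZL ZR))
  | exact: (E3 _ _ _ _ ZM) | exact: (E4 _ _ _ _ ZM)
  | by move: (E1 _ _ _ _ ZM); compare | by move: (E2 _ _ _ _ ZM); compare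
  | by move: (E1 _ _ _ _ (subseq_trans (mask_subseq [:: false; true; true; true; true] _) ZM)); compare
  | by move: (E2 _ _ _ _ (subseq_trans (mask_subseq [:: false; true; true; true; true] _) ZM)); compare ].
Qed.

Definition classP (h : nat) (s : seq nat) : bool :=
  [&& h <= size s, pairwise (fun x y => y < x) (take h s) & classB s].

Lemma classP_cons v L T : classP (size L).+1 (v :: L ++ T) =
  pairwise (fun x y => y < x) (v :: L) && classB (v :: L ++ T).
Proof. by rewrite /classP /= ltnS size_cat leq_addr /= take_size_cat. Qed.

(** The smaller letter v in front turns a 2413 or 1324 in M into a 13524 or 12435, so M must lie in
    E. *)
Lemma classP_block n v L M T :
  all (leq^~ n) (v :: L) -> all (fun x => n < x) M -> all (leq^~ n) T ->
  classP (size L).+1 (v :: L ++ M ++ T) = classE M && classP (size L).+1 (v :: L ++ T).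
Proof.
move=> aL aM aT; rewrite !classP_cons.
case dL: (pairwise _ _); rewrite ?andFb ?andbF // !andTb.
apply/idP/andP => [H|[HM HT]]; last exact: (@classB_block n (v :: L)).
split; last first.
  by apply: all_avoids_subseq H; rewrite /= eqxx cat_subseq // suffix_subseq.
have /classBP[B1 B2 B3 B4] := H.
have subM : subseq M (L ++ M ++ T).
  exact: (subseq_trans (prefix_subseq _ T) (suffix_subseq L _)).
have lt_vM := leq_ltn_trans (allP aL v (mem_head v L)).
apply/classEP; split=> a b c d Hs.
- have : subseq [:: v; a; b; c; d] (v :: L ++ M ++ T).
    by rewrite /= eqxx; apply: subseq_trans Hs subM.
  by move=> /B3; have := lt_vM c (allP aM c _); rewrite (mem_subseq Hs) ?inE ?eqxx ?orbT //; lia.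
- have : subseq [:: v; a; b; c; d] (v :: L ++ M ++ T).
    by rewrite /= eqxx; apply: subseq_trans Hs subM.
  by move=> /B4; have := lt_vM a (allP aM a _); rewrite (mem_subseq Hs) ?inE ?eqxx ?orbT //; lia.
- by apply: B1; apply: subseq_trans Hs (subseq_trans subM (subseq_cons _ _)).
by apply: B2; apply: subseq_trans Hs (subseq_trans subM (subseq_cons _ _)).
Qed.

Definition classQ (h : nat) (s : seq nat) : bool := classP h s && (blk h s == 0).

(** A letter x of T above v is below every m in the block: otherwise v, m, the first letter of T and
    x form a 2314. So the block has the largest values and can be removed. *)
Lemma num_classP_rec n h :
  num_of_size (classP h.+1) n =
    \sum_(b < n.+1) num_of_size classE b * num_of_size (classQ h.+1) (n - b).
Proof.
rewrite {1}/num_of_size (@count_fiber _ _ (blk h.+1) _ n.+1) => [|s Hs _]; last first.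
  by have := blk_size h.+1 s; rewrite (perms_size Hs); lia.
apply: eq_bigr => b _; have Hb : b <= n by rewrite -ltnS.
move: (nat_of_ord b) Hb => {}b Hb.
rewrite -{1}(subnK Hb) (@count_blk_sized _ _ h _ classE (classP h.+1)) //.
- by move=> s /andP[].
- by move=> s /andP[].
- move=> v L M T Hs <- SM vM vT Ps m x mM; have lt_vm := allP vM m mM.
  move: Ps; rewrite classP_cons mem_cat => /andP[/= /andP[dL _] /classBP[B1 _ _ _]].
  case/orP => [xL|xT]; first by apply: ltn_trans lt_vm; apply: (allP dL).
  case: (leqP x v) => [le_xv|lt_vx]; first exact: leq_ltn_trans lt_vm.
  have := perms_uniq Hs; rewrite /= !cat_uniq => /and4P[_ _ _ /and3P[_ /hasPn MT _]].
  have xm : x != m by apply: contraTneq mM => <-; apply: MT.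
  case: T vT xT B1 {Hs MT} => //= t T lt_tv; rewrite inE => /orP[/eqP Ext|xT] B1.
    by move: lt_vx; rewrite Ext ltnNge ltnW.
  have : subseq [:: v; m; t; x] (v :: L ++ M ++ t :: T).
    rewrite /= eqxx; apply: subseq_trans (suffix_subseq L _).
    have mM' : subseq [:: m] M by rewrite sub1seq.
    by apply: (@cat_subseq _ [:: m] [:: t; x] M (t :: T) mM'); rewrite /= eqxx sub1seq.
  by move=> /B1; move: xm lt_tv lt_vm lt_vx; rewrite /=; clear; lia.
- by move=> w; apply/all_avoids_map/addn_mono.
move=> v L M T _ <- _ _ aL aM aT; exact: (classP_block aL aM aT).
Qed.

Lemma classP_max_cons h v s : all (fun x => x < v) s ->
  classP h.+1 (v :: s) = classP h s.
Proof.
move=> Hv; rewrite /classP /= ltnS.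
have -> : all (fun x => x < v) (take h s) by apply/allP => x /mem_take/(allP Hv).
by rewrite /classB all_avoids_max_cons.
Qed.

Lemma classP_succ h s : classP h.+1 s -> classP h s.
Proof.
case/and3P => lt_hs dP Bs; rewrite /classP (ltnW lt_hs) Bs andbT /=.
apply: subseq_pairwise dP.
by rewrite -(take_takel s (leqnSn h)) take_subseq.
Qed.

(** With an empty block, either the first h + 2 letters decrease, or v is the maximum. In the second
    case, deleting v leaves h decreasing letters not followed by a further descent, which is counted
    by a difference of two values of P. *)
Lemma num_classQ n h :
  num_of_size (classQ h.+1) n.+1 + num_of_size (classP h.+1) n =
  num_of_size (classP h.+2) n.+1 + num_of_size (classP h) n.
Proof.
rewrite {1}/num_of_size (count_split _ (classP h.+2)) -addnA; congr (_ + _).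
  apply: eq_count => s /=; apply: andb_idl => Ps; rewrite /classQ (classP_succ Ps) /=.
  case/and3P: Ps; case: s => // v s lt_hs; rewrite /blk /= => /andP[dv _] _.
  rewrite (drop_nth 0) //= (allP dv) // -(nth_take 0 (ltnSn h)) mem_nth //.
  by rewrite size_takel.
rewrite [in RHS]/num_of_size (count_split (classP h) (classP h.+1)) [LHS]addnC; congr (_ + _).
  by apply: eq_count => s /=; rewrite andb_idl // => /classP_succ.
apply: count_max_first => [[|v s] Hs|s Hs /=]; first by have := perms_size Hs.
  case/andP => /andP[Ps /eqP Hb] Pn; apply: (head_max Hs); apply: (perms_all_lt Hs) => x.
  have lt_hs : h <= size s by case/andP: Ps.
  have [L [T [Es SL]]] : exists L T : seq nat, s = L ++ T /\ size L = h.
    by exists (take h s), (drop h s); rewrite cat_take_drop size_takel.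
  rewrite {}Es in Hs Ps Pn Hb *; rewrite -{}SL in Ps Pn Hb.
  have v0 : 0 < v by have /andP[] := perms_bounds Hs (mem_head v _).
  have {v0} lt_v : head 0 T < v.
    move: Hb; rewrite /blk /= drop_size_cat //.
    by case: (T) => //= t T'; case: (t < v).
  have := perms_uniq Hs; move: Ps; rewrite classP_cons => /andP[dL HB].
  have /= /andP[/allP vL _] := dL.
  rewrite /= mem_cat negb_or => /andP[/andP[_ vT] UT]; rewrite mem_cat => /orP[/vL/ltnW//|xT].
  rewrite leqNgt; apply/negP => lt_vx; case: T Hs Pn Hb lt_v HB vT UT xT => // t T Hs Pn _ /= lt_tv HB vT UT.
  rewrite inE => /orP[/eqP Ext|xT]; first by move: lt_vx; rewrite Ext ltnNge ltnW.
  move/negP: Pn; apply; rewrite /classP HB andbT; apply/andP; split.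
    by rewrite /= size_cat /= addnS !ltnS leq_addr.
  have -> : take (size L).+2 (v :: L ++ t :: T) = v :: rcons L t.
    by rewrite /= -cat_rcons take_size_cat ?size_rcons.
  move: dL => /= /andP[dv dL]; rewrite all_rcons lt_tv dv pairwise_rcons dL /= ?andbT.
  apply/allP => l lL; rewrite /= ltnNge; apply/negP => le_lt.
  have lt : l != t.
    move: UT; rewrite cat_uniq => /and3P[_ /hasPn H _].
    by apply: contraTneq lL => ->; apply: H; rewrite mem_head.
  (* If t exceeded some l in L, a letter x above v would complete the 3124 formed by v, l, t, x. *)
  have : subseq [:: v; l; t; x] (v :: L ++ t :: T).
    rewrite /= eqxx; have Zl : subseq [:: l] L by rewrite sub1seq.
    by apply: (@cat_subseq _ [:: l] [:: t; x] L (t :: T) Zl); rewrite /= eqxx sub1seq.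
  have /classBP[_ B2 _ _] := HB; move=> /B2; move: lt le_lt lt_tv lt_vx; clear; lia.
have Hn : all (fun x => x < n.+1) s by apply/allP => x /(perms_bounds Hs); lia.
rewrite /classQ !classP_max_cons //; case Ps: (classP h s) => //=.
by rewrite blk_head_max //= ltnS; case/andP: Ps.
Qed.

Lemma num_classP0 n : num_of_size (classP 0) n = num_of_size classB n.
Proof. by apply: eq_count => s; rewrite /classP take0. Qed.

Lemma num_classP01 n : num_of_size (classP 0) n.+1 = num_of_size (classP 1) n.+1.
Proof.
apply: eq_in_count => -[|v s] Hs; first by have := perms_size Hs.
by rewrite /classP /= take0.
Qed.

Lemma num_classP_small h n : n < h -> num_of_size (classP h) n = 0.
Proof.
move=> lt_nh; apply/eqP; rewrite -leqn0 leqNgt -has_count; apply/hasPn => s Hs.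
by rewrite /classP (perms_size Hs) leqNgt lt_nh.
Qed.

(** * Generating functions modulo powers of the variable *)

Import GRing.Theory Num.Theory.
Local Open Scope ring_scope.

(** The generating function truncated below degree N; identities of power series become congruences
    modulo ['X^N]. *)
Definition gf (N : nat) (u : nat -> nat) : {poly rat} := \poly_(i < N) (u i)%:R.

Definition eqmodX (N : nat) (p q : {poly rat}) : bool := 'X^N %| p - q.

Lemma eqmodXP N (p q : {poly rat}) :
  (forall i, (i < N)%N -> p`_i = q`_i) -> eqmodX N p q.
Proof.
move=> Hpq; rewrite /eqmodX -[p - q](poly_take_drop N).
suff -> : take_poly N (p - q) = 0 by rewrite add0r dvdp_mull.
apply/polyP => i; rewrite coef_take_poly coef0; case: ltnP => // /Hpq.
by rewrite coefB => ->; rewrite subrr.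
Qed.

Lemma coef_gf N u i : (i < N)%N -> (gf N u)`_i = (u i)%:R.
Proof. by rewrite coef_poly => ->. Qed.

Lemma coef_gfM N u v i : (i < N)%N ->
  (gf N u * gf N v)`_i = (\sum_(j < i.+1) u j * v (i - j))%N%:R.
Proof.
move=> lt_iN; rewrite coefM natr_sum; apply: eq_bigr => j _.
rewrite !coef_gf ?natrM //.
  exact: leq_ltn_trans (leq_subr _ _) lt_iN.
exact: leq_trans (ltn_ord j) lt_iN.
Qed.

(** A polynomial with nonzero constant term is coprime to ['X^N], so it acts as a unit. *)
Lemma eqmodX_coprime N (p u : {poly rat}) :
  u.[0] != 0 -> 'X^N %| p * u -> 'X^N %| p.
Proof.
move=> u0; rewrite Gauss_dvdpl // coprimep_expl //.
by rewrite coprimep_sym coprimepX.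
Qed.

Lemma classC_gf N : eqmodX N (gf N (num_of_size classC))
  (1 + 'X * (gf N (num_of_size classC) * gf N (num_of_size classC))).
Proof.
apply: eqmodXP => -[|i] lt_iN; rewrite coef_gf // coefD coef1 coefXM /=.
  by rewrite addr0 num_of_size0 /classC avoids_nil.
by rewrite add0r coef_gfM ?num_classC_rec // ltnW.
Qed.

Lemma gf_const N : eqmodX N ((1 - 'X) * gf N (fun=> 1%N)) 1.
Proof.
apply: eqmodXP => -[|i] lt_iN; rewrite mulrBl mul1r coefB coefXM coef1 coef_gf //=.
by rewrite coef_gf ?subrr // ltnW.
Qed.

Lemma classA_gf N (A := gf N (num_of_size classA)) :
  eqmodX N A (1 + 'X * (A * A) +
    'X * (gf N (num_of_size classC) * (A - gf N (fun=> 1%N)))).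
Proof.
have -> : A - gf N (fun=> 1%N) = gf N (fun n => num_of_size classA n - 1)%N.
  apply/polyP => i; rewrite coefB !coef_poly; case: ltnP => _; last by rewrite subrr.
  by rewrite natrB // num_classA_gt0.
apply: eqmodXP => -[|i] lt_iN; rewrite coef_gf // !coefD coef1 !coefXM /=.
  by rewrite !addr0 num_of_size0 /classA /= !avoids_nil.
by rewrite add0r !coef_gfM ?num_classA_rec 1?ltnW // big_split natrD.
Qed.

Lemma eqmodX_sum N m (F G : 'I_m -> {poly rat}) :
  (forall i, eqmodX N (F i) (G i)) -> eqmodX N (\sum_i F i) (\sum_i G i).
Proof.
move=> FG; rewrite /eqmodX -sumrB; apply: (big_ind (fun p => 'X^N %| p)) => [|p q|i _].
- exact: dvdp0.
- exact: dvdp_add.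
exact: FG.
Qed.

Lemma classF_max_gf N h : eqmodX N (gf N (num_of_size (classF_max h.+2)))
  ('X * (gf N (num_of_size classC) * gf N (num_of_size (classF_max h.+1)))).
Proof.
apply: eqmodXP => -[|i] lt_iN; rewrite coef_gf // coefXM /=.
  by rewrite num_classF_max_small.
by rewrite num_classF_max coef_gfM ?num_classF_rec // ltnW.
Qed.

Lemma classF_max1_gf N : eqmodX N (gf N (num_of_size (classF_max 1)))
  ('X * gf N (num_of_size classE)).
Proof.
apply: eqmodXP => -[|i] lt_iN; rewrite coef_gf // coefXM /=.
  by rewrite num_classF_max_small.
by rewrite num_classF_max num_classF0 coef_gf // ltnW.
Qed.

Lemma gf_small N h u : (N <= h)%N -> (forall n, (n < h)%N -> u n = 0%N) -> gf N u = 0.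
Proof.
move=> le_Nh Hu; apply/polyP => i; rewrite coef_poly coef0; case: ltnP => // lt_iN.
by rewrite Hu // (leq_trans lt_iN).
Qed.

(** The terms form a geometric series of ratio ['X] C that starts at ['X] E. The term that the index
    shift adds at the end vanishes, since its permutations have more than N letters. *)
Lemma classF_max_sum_gf N (S := \sum_(h < N) gf N (num_of_size (classF_max h.+1))) :
  eqmodX N S ('X * gf N (num_of_size classE) + 'X * (gf N (num_of_size classC) * S)).
Proof.
have F0 : gf N (num_of_size (classF_max N.+1)) = 0.
  by apply: gf_small (leqnSn N) _ => n; apply: num_classF_max_small.
have ES : S = gf N (num_of_size (classF_max 1)) +
              \sum_(h < N) gf N (num_of_size (classF_max h.+2)).
  by rewrite -(big_ord_recl N (fun h => gf N (num_of_size (classF_max h.+1))))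
    big_ord_recr /= F0 addr0.
have := eqmodX_sum (fun h : 'I_N => classF_max_gf N h); have := classF_max1_gf N.
rewrite /eqmodX {1}ES -!mulr_sumr => D1 D2.
by rewrite opprD addrACA; apply: dvdp_add.
Qed.

Lemma classE_gf N : eqmodX N (gf N (num_of_size classE))
  (1 + 'X * gf N (num_of_size classE) + (gf N (num_of_size classC) - 1) *
     \sum_(h < N) gf N (num_of_size (classF_max h.+1))).
Proof.
(* This stands for (C - 1) / X: the block in [num_classE_rec] is nonempty. *)
set C' := gf N (fun n => num_of_size classC n.+1).
have EC : eqmodX N (gf N (num_of_size classC) - 1) ('X * C').
  apply: eqmodXP => -[|i] lt_iN; rewrite coefB coef1 coef_gf // coefXM /=.
    by rewrite num_of_size0 /classC avoids_nil subrr.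
  by rewrite subr0 coef_gf // ltnW.
set S := \sum_(h < N) _.
suff HE : eqmodX N (gf N (num_of_size classE)) (1 + 'X * gf N (num_of_size classE) + 'X * (C' * S)).
  move: HE EC; rewrite /eqmodX => HE EC.
  rewrite (_ : _ - _ = gf N (num_of_size classE) - (1 + 'X * gf N (num_of_size classE) + 'X * (C' * S))
     - S * (gf N (num_of_size classC) - 1 - 'X * C')); last by ring.
  by rewrite dvdp_sub // dvdp_mull.
apply: eqmodXP => -[|i] lt_iN; rewrite coef_gf // !coefD coef1 !coefXM /=.
  by rewrite !addr0 num_of_size0 /classE /= !avoids_nil.
rewrite add0r mulr_sumr coef_sum coef_gf ?(ltnW lt_iN) //.
rewrite (num_classE_rec (ltnW (ltnW lt_iN))) natrD natr_sum; congr (_ + _).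
by apply: eq_bigr => h _; rewrite coef_gfM // ltnW.
Qed.

Lemma classP_gf N h : eqmodX N (gf N (num_of_size (classP h.+1)))
  (gf N (num_of_size classE) *
   (gf N (num_of_size (classP h.+2)) +
    'X * (gf N (num_of_size (classP h)) - gf N (num_of_size (classP h.+1))))).
Proof.
set P := fun h => gf N (num_of_size (classP h)).
rewrite -/(P h) -/(P h.+1) -/(P h.+2); set E := gf N _.
set Q := gf N (num_of_size (classQ h.+1)).
have HP : eqmodX N (P h.+1) (E * Q).
  by apply: eqmodXP => i lt_iN; rewrite coef_gf // coef_gfM // num_classP_rec.
have HQ : eqmodX N (Q + 'X * P h.+1) (P h.+2 + 'X * P h).
  by apply: eqmodXP => -[|i] lt_iN; rewrite !coefD !coefXM !coef_gf ?(ltnW lt_iN) //=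
    -!natrD num_classQ.
move: HP HQ; rewrite /eqmodX => HP HQ.
rewrite (_ : _ - _ = P h.+1 - E * Q + E * (Q + 'X * P h.+1 - (P h.+2 + 'X * P h))).
  by rewrite dvdp_add // dvdp_mull.
by ring.
Qed.

Lemma classP0_gf N :
  eqmodX N (gf N (num_of_size (classP 0))) (1 + gf N (num_of_size (classP 1))).
Proof.
apply: eqmodXP => -[|i] lt_iN; rewrite coefD coef1 !coef_gf //=.
  by rewrite num_classP0 (@num_classP_small 1) // num_of_size0 /classB /= !avoids_nil.
by rewrite add0r num_classP01.
Qed.

(** Congruences are derived by writing a difference as a combination of known multiples of ['X^N].
    The identity is left to [ring], divisibility to this tactic. *)
Ltac dvdp_comb :=
  repeat first [ by [] | apply: dvdp_sub | apply: dvdp_add | apply: dvdp_mull ].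

(* P h.+1 * P 0 - P h * P 1 satisfies the recurrence and is 0 at h = 0, so it is a multiple
   of its value at h = 1, with invertible cofactor for h > 0; and it is 0 at h = N. *)
Lemma recurrence_vanishing N (a : {poly rat}) (P : nat -> {poly rat}) :
  a.[0] = 1 -> (forall h, 'X^N %| P h.+2 - (a * P h.+1 - 'X * P h)) ->
  (forall h, (N <= h)%N -> P h = 0) -> 'X^N %| P 2 * P 0 - P 1 * P 1.
Proof.
move=> a0 recP P0; set W := P 2 * P 0 - P 1 * P 1.
have prop h : exists u v : {poly rat}, [/\ 'X^N %| P h.+1 * P 0 - P h * P 1 - u * W,
    'X^N %| P h.+2 * P 0 - P h.+1 * P 1 - v * W & v.[0] = 1].
  elim: h => [|h [u [v [Hu Hv v0]]]].
    exists (0 : {poly rat}), (1 : {poly rat}); split; last by rewrite hornerC.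
      by rewrite (_ : _ - _ = 0) ?dvdp0 //; ring.
    by rewrite (_ : _ - _ = 0) ?dvdp0 // /W; ring.
  (* The cofactors follow the recurrence of P, and a(0) = 1 keeps the constant term of the second
     one equal to 1. *)
  exists v, (a * v - 'X * u); split => //; last first.
    by rewrite hornerD hornerN !hornerM hornerX a0 v0 mul0r subr0 mulr1.
  have := recP h.+1; have := recP h => R1 R2.
  rewrite (_ : _ - _ = P 0 * (P h.+3 - (a * P h.+2 - 'X * P h.+1))
     - P 1 * (P h.+2 - (a * P h.+1 - 'X * P h))
     + a * (P h.+2 * P 0 - P h.+1 * P 1 - v * W)
     - 'X * (P h.+1 * P 0 - P h * P 1 - u * W)); last by ring.
  by dvdp_comb.
have [u [v [_ Hv v0]]] := prop N.
apply: (@eqmodX_coprime _ _ v); first by rewrite v0 oner_neq0.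
move: Hv; rewrite (P0 N.+2) ?leqW // (P0 N.+1) ?leqW // !mul0r subrr sub0r mulrC.
by rewrite dvdpNr.
Qed.

(** Both series are roots of (1 - X)(C - 1) Y^2 - (1 - X) C Y + 1. The modulus has exponent N + 1 so
    as to reach the coefficient of index N. *)
Lemma gf_classA_classB N :
  'X^(N.+1) %| gf N.+1 (num_of_size classA) - gf N.+1 (num_of_size classB).
Proof.
set A := gf _ _; set B := gf _ _.
have := classA_gf N.+1; have := gf_const N.+1; have := classC_gf N.+1.
have := classE_gf N.+1; have := classF_max_sum_gf N.+1.
have := classP0_gf N.+1; have := fun h => classP_gf N.+1 h.
have Pv h : (N < h)%N -> gf N.+1 (num_of_size (classP h)) = 0.
  by move=> lt_Nh; apply: gf_small lt_Nh _ => n; apply: num_classP_small.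
have EB : gf N.+1 (num_of_size (classP 0)) = B.
  by apply/polyP => i; rewrite !coef_poly num_classP0.
have C0 : (gf N.+1 (num_of_size classC)).[0] = 1.
  by rewrite horner_coef0 coef_gf // num_of_size0 /classC avoids_nil.
pose P h := gf N.+1 (num_of_size (classP h)).
rewrite /eqmodX -/A EB -(_ : P 1 = gf N.+1 (num_of_size (classP 1))) //.
move: (\sum_(h < _) _) (gf _ (fun=> 1%N)) (gf _ (num_of_size classE))
  (gf _ (num_of_size classC)) C0 => S J E C C0 recP DB DS DE DC DJ DA.
(* The inverse of E: S = X C E, combined with X C^2 = C - 1, turns the equation of E into E k =
   1. *)
set k := 2 - 'X - (1 - 'X) * C.
have Dk : 'X^(N.+1) %| E * k - 1.
  rewrite (_ : _ - _ = (E - (1 + 'X * E + (C - 1) * S)) - E * (C - (1 + 'X * (C * C)))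
    + (C - 1) * (C * (S - ('X * E + 'X * (C * S))) - S * (C - (1 + 'X * (C * C))))).
    by dvdp_comb.
  by rewrite /k; ring.
have linP h : 'X^(N.+1) %| P h.+2 - ((k + 'X) * P h.+1 - 'X * P h).
  rewrite (_ : _ - _ = (- (P h.+2 + 'X * (P h - P h.+1))) * (E * k - 1)
     - k * (P h.+1 - E * (P h.+2 + 'X * (P h - P h.+1)))); last by ring.
  by have := recP h => R; dvdp_comb.
have DW : 'X^(N.+1) %| P 2 * P 0 - P 1 * P 1.
  apply: (@recurrence_vanishing _ (k + 'X)) => [|h|h]; [|exact: linP|exact: Pv].
  by rewrite /k !(hornerE, C0); ring.
(* The difference of the two equations below factors as (A - B) times a unit. *)
have quadA : 'X^(N.+1) %| (1 - 'X) * (C - 1) * A ^+ 2 - (1 - 'X) * C * A + 1.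
  (* The equation of A is multiplied by (1 - X) C^2; then J is eliminated by (1 - X) J = 1, and X
     C^2 is replaced by C - 1. *)
  rewrite (_ : _ + 1 = C ^+ 2 * ('X * C * ((1 - 'X) * J - 1)
      - (1 - 'X) * (A - (1 + 'X * (A * A) + 'X * (C * (A - J)))))
    + ((1 - 'X) * A ^+ 2 + (1 - 'X) * C * A - (1 + C)) * (C - (1 + 'X * (C * C))));
    last by ring.
  by dvdp_comb.
have quadB : 'X^(N.+1) %| (1 - 'X) * (C - 1) * B ^+ 2 - (1 - 'X) * C * B + 1.
  have := linP 0%N; move: DW; rewrite (EB : P 0 = B) => DW R.
  (* P 2 is eliminated between the recurrence at h = 0 and P 2 * B = P 1 ^ 2, and P 1 is replaced by
     B - 1. *)
  rewrite (_ : _ + 1 = B * (P 2 - ((k + 'X) * P 1 - 'X * B)) - (P 2 * B - P 1 * P 1)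
    - ((k + 'X) * B - 2 * P 1 - (B - (1 + P 1))) * (B - (1 + P 1)));
    last by rewrite /k; ring.
  by dvdp_comb.
apply: (@eqmodX_coprime _ _ ((1 - 'X) * ((C - 1) * (A + B) - C))).
  by rewrite !(hornerE, C0) ?subrr ?mul0r ?subr0 ?add0r ?mul1r ?sub0r ?oppr_eq0 oner_neq0.
rewrite (_ : (A - B) * _ = (1 - 'X) * (C - 1) * A ^+ 2 - (1 - 'X) * C * A + 1
  - ((1 - 'X) * (C - 1) * B ^+ 2 - (1 - 'X) * C * B + 1)); last by ring.
by dvdp_comb.
Qed.

Lemma num_classA_classB n : num_of_size classA n = num_of_size classB n.
Proof.
have /dvdpP[r /(congr1 (fun p : {poly rat} => p`_n))] := gf_classA_classB n.
rewrite coefB !coef_gf // coefMXn ltnSn => /eqP; rewrite subr_eq0 => /eqP.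
by move/eqP; rewrite eqr_nat => /eqP.
Qed.

Local Close Scope ring_scope.

Lemma num_of_size_Av P n : num_of_size (Av P) n = num_of_size (fun s => all (avoids s) P) n.
Proof.
by apply: eq_in_count => s; rewrite mem_permutations_iota /Av /= => /andP[-> _].
Qed.

Theorem theorem11p2 :
  Wilf_equivalent
    (Av [:: [:: 2; 1; 3; 4]; [:: 2; 4; 1; 3]])
    (Av [:: [:: 2; 3; 1; 4]; [:: 3; 1; 2; 4];
            [:: 1; 3; 5; 2; 4]; [:: 1; 2; 4; 3; 5]]).
Proof. by move=> n; rewrite !num_of_size_Av num_classA_classB. Qed.
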